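(* Let $q \geq 2$ be an integer and let $\mathcal{P}$ be a finite chiral abstract $4$-polytope of type $\{3,q,3\}$, with medial layer graph $\mathcal{G}$. If $\mathcal{G}$ is vertex-transitive, then $\mathcal{G}$ is $2$-transitive and $\mathcal{P}$ is self-dual.
   Context: An abstract $4$-polytope is a partially ordered set $\mathcal{P}$ with a strictly monotone rank function onto $\{-1,0,1,2,3,4\}$, having a unique least face (rank $-1$) and a unique greatest face (rank $4$), such that every maximal chain (flag) contains exactly $6$ faces; whenever $F<G$ with $\mathrm{rank}(F)=j-1$, $\mathrm{rank}(G)=j+1$ there are exactly two faces $H$ of rank $j$ with $F<H<G$; and $\mathcal{P}$ is strongly flag-connected (for every section $G/F=\{H: F\le H\le G\}$, the graph on its flags, with flags adjacent when they differ in exactly one face, is connected). Faces of rank $j$ are $j$-faces. $\mathcal{P}$ is of type $\{p_1,p_2,p_3\}$ if for $j=1,2,3$, whenever $F<G$ with $\mathrm{rank}(F)=j-2$, $\mathrm{rank}(G)=j+1$, the section $G/F$ is a $p_j$-gon. $\mathcal{P}$ is regular if its automorphism group (order-preserving bijections) acts transitively on flags. $\mathcal{P}$ is chiral if it is not regular but, for a base flag $\{F_{-1},F_0,\dots,F_4\}$, there exist automorphisms $\sigma_1,\sigma_2,\sigma_3$ such that $\sigma_j$ fixes all faces of the base flag other than $F_{j-1},F_j$ and cyclically permutes consecutive $j$-faces in the rank-2 section $F_{j+1}/F_{j-2}$ (equivalently, the automorphism group has exactly two orbits on flags, with adjacent flags in different orbits). $\mathcal{P}$ is self-dual if it admits an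 order-reversing bijection onto itself. The medial layer graph $\mathcal{G}$ of $\mathcal{P}$ is the simple graph whose vertices are the $1$-faces and $2$-faces of $\mathcal{P}$, adjacent when incident; for type $\{3,q,3\}$ it is trivalent. A $t$-arc is a sequence of vertices $v_0,\dots,v_t$ with consecutive vertices adjacent and $v_{i-1}\neq v_{i+1}$. A graph is $t$-transitive if its automorphism group is transitive on $t$-arcs but not on $(t+1)$-arcs. *)

(* Defs.v *)
From mathcomp Require Import all_boot all_order all_algebra all_fingroup.

Set Implicit Arguments.
Unset Strict Implicit.
Unset Printing Implicit Defensive.

Import Order.TTheory GRing.Theory Num.Theory.

Local Open Scope order_scope.

Section Posets.
Context {d : Order.disp_t} {P : finPOrderType d}.
Implicit Types (F G : P) (A B S : {set P}) (f : {perm P}).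

Definition is_chain A : bool := [forall x in A, forall y in A, x >=< y].

(* Flags of the subposet S, i.e. its maximal chains. *)
Definition is_flag_of S A : bool :=
  maxset [pred B : {set P} | is_chain B && (B \subset S)] A.

Definition is_flag A : bool := is_flag_of setT A.

Definition section F G : {set P} := [set H | F <= H <= G].

Definition flag_adjacent A B : bool :=
  (#|A :\: B| == 1)%N && (#|B :\: A| == 1)%N.

Definition flag_connected S : Prop :=
  forall A B, is_flag_of S A -> is_flag_of S B ->
    connect [rel X Y | [&& is_flag_of S X, is_flag_of S Y & flag_adjacent X Y]]
            A B.

Definition poset_aut f : Prop := forall x y, (f x <= f y) = (x <= y).

Definition poset_duality f : Prop := forall x y, (f x <= f y) = (y <= x).

End Posets.

Definition self_dual {d : Order.disp_t} (P : finPOrderType d) : Prop :=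
  exists f : {perm P}, poset_duality f.

Definition regular {d : Order.disp_t} (P : finPOrderType d) : Prop :=
  forall A B : {set P}, is_flag A -> is_flag B ->
    exists2 f : {perm P}, poset_aut f & f @: A = B.

Record is_4polytope {d : Order.disp_t} (P : finPOrderType d) (rk : P -> int) :
    Prop := Is4Polytope {
  rank_strict_mono : forall x y, x < y -> rk x < rk y;
  rank_range : forall x, (-1)%R <= rk x <= 4%R;
  rank_onto : forall j : int, (-1)%R <= j <= 4%R -> exists x, rk x = j;
  least_face : exists2 x, rk x = (-1)%R & forall y, x <= y;
  greatest_face : exists2 x, rk x = 4%R & forall y, y <= x;
  flag_card : forall A : {set P}, is_flag A -> #|A| = 6%N;
  diamond : forall (j : int) (F G : P),
    F < G -> rk F = (j - 1)%R -> rk G = (j + 1)%R ->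
    #|[set H : P | (rk H == j) && (F < H < G)]| = 2%N;
  strongly_flag_connected : forall F G : P,
    F <= G -> flag_connected (section F G)
}.

Section RankedPosets.
Context {d : Order.disp_t} {P : finPOrderType d}.
Variable rk : P -> int.
Implicit Types (F G : P).

(* v and e list, without repetition, the vertices and the edges of the rank 2
   section G/F in cyclic order: the edge e k has the two vertices v k and
   v (k + 1), the index being read modulo p.  This includes the digon (p = 2). *)
Definition polygon_labelling (p : nat) F G (v e : 'I_p -> P) : Prop :=
  [/\ injective v, injective e,
      forall x, (F < x < G /\ rk x = (rk F + 1)%R) <-> exists i, x = v i,
      forall x, (F < x < G /\ rk x = (rk F + 2)%R) <-> exists k, x = e k
    & forall i k, (v i < e k) = (i == k) || (i == ordS k)].

Definition is_polygon (p : nat) F G : Prop :=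
  exists v e : 'I_p -> P, polygon_labelling F G v e.

Definition has_type (p1 p2 p3 : nat) : Prop :=
  forall F G, F < G ->
    [/\ rk F = (-1)%R -> rk G = 2%R -> is_polygon p1 F G,
        rk F = 0%R -> rk G = 3%R -> is_polygon p2 F G
      & rk F = 1%R -> rk G = 4%R -> is_polygon p3 F G].

Definition cyclically_permutes_edges (s : {perm P}) F G : Prop :=
  exists p (v e : 'I_p -> P),
    polygon_labelling F G v e /\ forall k, s (e k) = e (ordS k).

Definition is_rotation (A : {set P}) (j : int) (s : {perm P}) : Prop :=
  [/\ poset_aut s,
      forall x, x \in A -> rk x <> (j - 1)%R -> rk x <> j -> s x = x
    & forall F G, F \in A -> G \in A ->
        rk F = (j - 2)%R -> rk G = (j + 1)%R -> cyclically_permutes_edges s F G].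

Definition chiral : Prop :=
  ~ regular P /\
  exists2 A : {set P}, is_flag A &
    exists s1 s2 s3 : {perm P},
      [/\ is_rotation A 1%R s1, is_rotation A 2%R s2 & is_rotation A 3%R s3].

Definition medial_vertex : finType :=
  {x : P | (rk x == 1%R) || (rk x == 2%R)}.

Definition medial_layer_graph : rel medial_vertex :=
  [rel x y | (val x < val y) || (val y < val x)].

End RankedPosets.

Arguments medial_layer_graph {d P} rk.

Section Graphs.
Context {V : finType}.
Variable e : rel V.

Definition graph_aut (f : {perm V}) : Prop := forall x y, e (f x) (f y) = e x y.

Definition vertex_transitive : Prop :=
  forall x y : V, exists2 f : {perm V}, graph_aut f & f x = y.

Definition is_arc (t : nat) (v : 'I_t.+1 -> V) : Prop :=
  (forall i k : 'I_t.+1, k = i.+1 :> nat -> e (v i) (v k)) /\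
  (forall i k : 'I_t.+1, k = i.+2 :> nat -> v i <> v k).

Definition arc_transitive (t : nat) : Prop :=
  forall v w : 'I_t.+1 -> V, is_arc v -> is_arc w ->
    exists2 f : {perm V}, graph_aut f & forall i, f (v i) = w i.

Definition t_transitive (t : nat) : Prop :=
  arc_transitive t /\ ~ arc_transitive t.+1.

End Graphs.

(* Main.v *)
(**
Let G be the medial layer graph, A its automorphism group, and for a vertex x
let K_x be the subgroup of A fixing x and all its neighbours.

Two edges of a triangle share exactly one vertex, and dually; hence a vertex or
facet of P is recovered from the arcs (b1, c, b2, c', b3) of G whose three
entries b1, b2, b3 share it (straight arcs), and an automorphism of G that
preserves straight arcs extends to an automorphism or a duality of P.  An arc is
straight exactly when the rotation of order 3 about b2 moving c to c' moves b1
to b3.  So it suffices that A conjugates the rotations of order 3 at x to those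
at the image of x, and this follows from [K_x :&: K_y = 1] for adjacent x and y:
then K_x has order at most 2, and A_x has a single subgroup of order 3.

To prove [K_x :&: K_y = 1], use that the half-turns of P provide, for every edge
xy, an involution of A_xy acting non-trivially around both x and y.  Assuming
K_x :&: K_y <> 1, let V_x be the group generated by the involutions in the
centres of the 2-groups A_xy, y adjacent to x, and let n be the least length of
an arc from x to z with V_x not contained in K_z.  The involution above excludes
n = 1; for n > 1 the commutator of V_x and V_z is determined by each of the two
ends of the arc, which forces a normal subgroup fixing every vertex if n > 2,
and contradictory relations between these commutators along a 5-arc if n = 2.

Thus, when G is vertex-transitive, an automorphism of G exchanging 1-faces and
2-faces gives a duality, Aut P is transitive on the 2-arcs of each type, and
transitivity on 3-arcs would make P regular because 3-arcs correspond to flags.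
*)

Require Import Defs.
From mathcomp Require Import all_boot all_order all_algebra all_fingroup.
From mathcomp Require Import commutator pgroup center nilpotent sylow zify.

Set Implicit Arguments.
Unset Strict Implicit.
Unset Printing Implicit Defensive.

Import Order.TTheory GRing.Theory Num.Theory.

(** * Cubic graphs *)

Section CubicGraph.
Local Open Scope group_scope.
Variables (T : finType) (e : rel T).
Hypothesis e_sym : symmetric e.
Hypothesis e_cubic : forall x, #|[set y | e x y]| = 3.
Hypothesis e_conn : forall x y, connect e x y.

(** * Automorphisms, arc stabilisers and local kernels *)

Definition aut_set := [set f : {perm T} | [forall x, forall y, e (f x) (f y) == e x y]].

Lemma aut_setP f : reflect (graph_aut e f) (f \in aut_set).
Proof.
rewrite inE; apply: (iffP idP) => [/forallP H x y|H].
  by have /forallP /(_ y) /eqP := H x.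
by apply/forallP=> x; apply/forallP=> y; apply/eqP.
Qed.

Lemma aut_group_set : group_set aut_set.
Proof.
apply/group_setP; split=> [|f g /aut_setP Hf /aut_setP Hg]; apply/aut_setP=> x y.
  by rewrite !perm1.
by rewrite !permM Hg Hf.
Qed.
Canonical aut_group := group aut_group_set.
Local Notation A := aut_group.

Lemma graph_autE f x y : f \in A -> e (f x) (f y) = e x y.
Proof. by move/aut_setP=> H; exact: H. Qed.

(* [locked] keeps [inE] from unfolding membership in these groups. *)
Definition stab x y : {group {perm T}} := locked 'C_A([set x; y] | 'P)%G.
Definition nbfix x : {group {perm T}} := locked 'C_A([set y | (y == x) || e x y] | 'P)%G.

Lemma stabP x y g : reflect [/\ g \in A, g x = x & g y = y] (g \in stab x y).
Proof.
rewrite /stab -lock /= in_setI; apply: (iffP andP) => [[gA /astabP H]|[gA gx gy]].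
  by split=> //; apply: H; rewrite !inE eqxx ?orbT.
by split=> //; apply/astabP=> z; rewrite !inE => /orP[]/eqP->.
Qed.

Lemma nbfixP x g : reflect [/\ g \in A, g x = x & forall y, e x y -> g y = y] (g \in nbfix x).
Proof.
rewrite /nbfix -lock /= in_setI; apply: (iffP andP) => [[gA /astabP H]|[gA gx gy]].
  split=> //; first by apply: H; rewrite !inE eqxx.
  by move=> y xy; apply: H; rewrite !inE xy orbT.
by split=> //; apply/astabP=> z; rewrite !inE => /orP[/eqP->|/gy].
Qed.

Lemma stabC x y : stab x y = stab y x.
Proof. by rewrite /stab setUC. Qed.

Lemma ker_stab x y : e x y -> nbfix x \subset stab x y.
Proof. by move=> xy; apply/subsetP=> g /nbfixP[gA gx gy]; apply/stabP; split=> //; exact: gy. Qed.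

Lemma ker_stab' x y : e x y -> nbfix x \subset stab y x.
Proof. by rewrite stabC; exact: ker_stab. Qed.

Lemma conj_stab g x y h : g \in A -> h \in stab x y -> h ^ g \in stab (g x) (g y).
Proof.
move=> gA /stabP[hA hx hy]; apply/stabP; split; first by rewrite groupJ.
  by rewrite permJ hx.
by rewrite permJ hy.
Qed.

Lemma conj_ker g x h : g \in A -> h \in nbfix x -> h ^ g \in nbfix (g x).
Proof.
move=> gA /nbfixP[hA hx hy]; apply/nbfixP; split; first by rewrite groupJ.
  by rewrite permJ hx.
move=> y; rewrite -[y](permKV g) graph_autE // => xy.
by rewrite permJ hy.
Qed.

Lemma conj_kerE g x h : g \in A -> (h ^ g \in nbfix (g x)) = (h \in nbfix x).
Proof.
move=> gA; apply/idP/idP; last exact: conj_ker.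
by move/(@conj_ker g^-1 (g x)); rewrite groupV gA conjgK permK; apply.
Qed.

Lemma third x y z : e x y -> e x z -> y != z ->
  exists u, [/\ e x u, u != y, u != z & forall t, e x t -> [|| t == y, t == z | t == u]].
Proof.
move=> xy xz yz.
have H : #|[set y | e x y] :\ y :\ z| = 1%N.
  have := e_cubic x; rewrite (cardsD1 y) inE xy (cardsD1 z) !inE eq_sym yz xz /=.
  by move=> [].
have /cards1P[u uE] : #|[set y | e x y] :\ y :\ z| == 1%N by apply/eqP.
have : u \in [set u] by rewrite inE.
rewrite -uE !inE => /and3P[uz uy xu]; exists u; split=> // t xt.
have : (t \in [set y | e x y] :\ y :\ z) = (t == u) by rewrite uE inE.
by rewrite !inE xt andbT => <-; case: (t == y); case: (t == z).
Qed.

Lemma other2 x y : e x y ->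
  exists u u', [/\ e x u, e x u', u != y, u' != y & u != u']
     /\ forall t, e x t -> [|| t == y, t == u | t == u'].
Proof.
move=> xy.
have : [set y | e x y] :\ y != set0.
  by rewrite -card_gt0; have := e_cubic x; rewrite (cardsD1 y) inE xy /= add1n => -[->].
case/set0Pn=> u; rewrite !inE => /andP[uy xu].
have yu : y != u by rewrite eq_sym.
have [u' [xu' u'y u'u H]] := third xy xu yu.
by exists u, u'; split=> //; split=> //; rewrite eq_sym.
Qed.

(** Outside [nbfix x], an element of [stab x y] swaps the two neighbours of [x] other than [y], and
    two such swaps cancel. So [nbfix x] has index at most 2 in [stab x y]. *)
Lemma stab_mul_ker x y s t : e x y -> s \in stab x y -> t \in stab x y ->
  s \notin nbfix x -> t \notin nbfix x -> s * t \in nbfix x.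
Proof.
move=> xy sS tS sK tK.
have [u [u' [[xu xu' uy u'y uu'] H]]] := other2 xy.
have swap r : r \in stab x y -> r \notin nbfix x -> r u = u' /\ r u' = u.
  move=> /stabP[rA rx ry] rK.
  have ne z : (r z == y) = (z == y) by rewrite -{1}ry (inj_eq perm_inj).
  have xe z : e x z -> e x (r z) by move=> xz; rewrite -rx graph_autE.
  have ru : r u != u.
    apply: contra rK => /eqP ru; apply/nbfixP; split=> // t' /H /or3P[]/eqP-> //.
    have /H := xe _ xu'; rewrite ne (negPf u'y) /= -[X in _ == X]ru (inj_eq perm_inj).
    by rewrite eq_sym (negPf uu') /= => /eqP.
  have E1 : r u = u'.
    by have /H := xe _ xu; rewrite ne (negPf uy) (negPf ru) /= => /eqP.
  split=> //; have /H := xe _ xu'.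
  rewrite ne (negPf u'y) /= -[X in _ || (_ == X)]E1 (inj_eq perm_inj).
  by rewrite [u' == u]eq_sym (negPf uu') orbF => /eqP.
have [su su'] := swap s sS sK; have [tu tu'] := swap t tS tK.
case/stabP: sS => sA sx sy; case/stabP: tS => tA tx ty.
apply/nbfixP; split; first by rewrite groupM.
  by rewrite permM sx.
by move=> z /H /or3P[]/eqP->; rewrite permM ?sy ?su ?su'.
Qed.

Lemma stab_moves x y s u : s \in stab x y -> e x y -> s \notin nbfix x -> e x u -> u != y ->
  s u != u.
Proof.
move=> sS xy sK xu uy; apply: contra sK => /eqP su; case/stabP: sS => sA sx sy.
have yu : y != u by rewrite eq_sym.
have [u' [xu' u'y u'u H]] := third xy xu yu.
apply/nbfixP; split=> // t /H /or3P[]/eqP-> //.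
have : e x (s u') by rewrite -sx graph_autE.
case/H/or3P=> /eqP // E.
  by case/eqP: u'y; apply: (@perm_inj _ s); rewrite E sy.
by case/eqP: u'u; apply: (@perm_inj _ s); rewrite E su.
Qed.

(* Such a family is the same for all arcs by connectedness. *)
Lemma family_trivial (N : T -> T -> {set {perm T}}) :
  (forall x y n, e x y -> n \in N x y -> n x = x) ->
  (forall x y, e x y -> N x y \subset N y x) ->
  (forall x y y', e x y -> e x y' -> y != y' -> N x y \subset N x y') ->
  forall x y n, e x y -> n \in N x y -> n = 1.
Proof.
move=> fixN symN nbN x y n xy nN; apply/permP=> z; rewrite perm1.
have : exists2 t, e z t & n \in N z t.
  have /connectP[p] := e_conn x z.
  elim: p x y xy nN => [|u p IH] x y xy nN /=; first by move=> _ ->; exists y.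
  case/andP=> xu pp lp; apply: (IH u x) => //; first by rewrite e_sym.
  apply: (subsetP (symN _ _ xu)).
  by have [<-//|yu] := eqVneq y u; apply: (subsetP (nbN _ _ _ xy xu yu)).
by case=> t zt; exact: fixN.
Qed.

(** By Cauchy it suffices to exclude [g] of odd prime order. It is a power of its square, so it lies
    in [nbfix u] whenever it lies in [stab u v]; by connectedness it then fixes every vertex. *)
Lemma stab_pgroup x y : e x y -> 2.-group (stab x y).
Proof.
move=> xy; apply/pgroupP=> p p_pr /Cauchy -/(_ p_pr) [g gS og].
rewrite inE /=; apply/idPn=> p2.
have oddg : g = (g * g) ^+ (p.+1)./2.
  have op : odd p by case/even_prime: p_pr p2 => [->|].
  rewrite -expg2 -expgM mul2n even_halfK; last by rewrite /= op.
  by rewrite expgS -og expg_order mulg1.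
have key u v : e u v -> g \in stab u v -> g \in nbfix u.
  move=> uv gu; apply/idPn=> gK; case/negP: (gK).
  by rewrite oddg groupX // (stab_mul_ker uv).
have g1 : g = 1.
  apply: (@family_trivial (fun u v => [set h in stab u v | h == g]) _ _ _ x y) => //.
  - by move=> u v n _; rewrite inE => /andP[/stabP[]].
  - by move=> u v _; apply/subsetP=> h; rewrite !inE stabC.
  - move=> u v v' uv uv' _; apply/subsetP=> h; rewrite !inE => /andP[hS /eqP hg].
    by rewrite hg eqxx andbT (subsetP (ker_stab uv')) // (key _ _ uv) -?hg.
  by rewrite inE gS eqxx.
by move: og p_pr; rewrite g1 order1 => <-.
Qed.


Hypothesis vt : forall x y, exists2 g, g \in A & g x = y.
Hypothesis rot : forall x, exists b, [/\ b \in A, b x = x & forall y, e x y -> b y != y].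
Hypothesis tau : forall x y, e x y ->
  exists t, [/\ t \in stab x y, t * t = 1, t \notin nbfix x & t \notin nbfix y].

(** A permutation of three neighbours without fixed point is a 3-cycle, so [b] or its square takes
    [y] to [z]. *)
Lemma local_transitive x y z : e x y -> e x z ->
  exists g, [/\ g \in A, g x = x & g y = z].
Proof.
move=> xy xz; have [b [bA bx bm]] := rot x.
have eb u : e x u -> e x (b u) by move=> xu; rewrite -bx graph_autE.
have [->|yz] := eqVneq y z; first by exists 1; rewrite !perm1 group1.
have [u [xu uy uz H]] := third xy xz yz.
have [byz|byz] := eqVneq (b y) z; first by exists b.
have byu : b y = u.
  by have := H _ (eb _ xy); rewrite (negPf (bm _ xy)) (negPf byz) /= => /eqP.
exists (b * b); split; rewrite ?groupM // !permM ?bx // byu.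
have := H _ (eb _ xu); rewrite (negPf (bm _ xu)) orbF => /orP[]/eqP // E.
have := H _ (eb _ xz); rewrite (negPf (bm _ xz)) /= => /orP[]/eqP E'.
  by case/eqP: uz; apply: (@perm_inj _ b); rewrite E E'.
by case/eqP: yz; apply: (@perm_inj _ b); rewrite byu E'.
Qed.

Lemma arc1_transitive x y x' y' : e x y -> e x' y' ->
  exists g, [/\ g \in A, g x = x' & g y = y'].
Proof.
move=> xy xy'; have [g gA gx] := vt x x'.
have : e x' (g y) by rewrite -gx graph_autE.
case/local_transitive/(_ xy')=> h [hA hx hy].
by exists (g * h); rewrite groupM // !permM gx.
Qed.

(** * Central involutions of the edge stabilisers *)

Lemma invol_inv (k : {perm T}) : k * k = 1 -> k^-1 = k.
Proof. by move=> kk; apply/eqP; rewrite eq_invg_mul kk. Qed.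

(** For a 2-group [G] this is the subgroup Omega_1 of the centre, identity included. *)
Definition involZ (G : {set {perm T}}) := [set z in 'Z(G) | z * z == 1].

Lemma involZ_group (G : {group {perm T}}) : group_set (involZ G).
Proof.
apply/group_setP; split=> [|x y]; first by rewrite in_set group1 mul1g eqxx.
rewrite ![_ \in involZ _]in_set => /andP[xZ /eqP xx] /andP[yZ /eqP yy].
rewrite groupM //=; apply/eqP.
have /setIP[_ /centP xC] := xZ; have /setIP[yG _] := yZ; have xy := xC _ yG.
by rewrite mulgA -(mulgA x y) -xy (mulgA x x) xx mul1g yy.
Qed.
Canonical involZ_group_of G := group (involZ_group G).

Lemma involZP (G : {group {perm T}}) z :
  reflect [/\ z \in G, forall g, g \in G -> commute z g & z * z = 1] (z \in involZ G).
Proof.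
rewrite in_set; apply: (iffP andP) => [[/setIP[zG /centP zC] /eqP zz]|[zG zC zz]] //.
by rewrite zz; split=> //; apply/setIP; split=> //; apply/centP.
Qed.

Definition zed x y := locked (involZ (stab x y)).

Lemma zedP x y z : reflect [/\ z \in stab x y, forall g, g \in stab x y -> commute z g
  & z * z = 1] (z \in zed x y).
Proof. by rewrite /zed -lock; exact: involZP. Qed.

Lemma zedC x y : zed x y = zed y x.
Proof. by rewrite /zed stabC. Qed.

Lemma zed_conj g x y z : g \in A -> z \in zed x y -> z ^ g \in zed (g x) (g y).
Proof.
move=> gA /zedP[zS zC zz]; apply/zedP; split; first exact: conj_stab.
  move=> h hS; have hS' : h ^ g^-1 \in stab x y.
    by have := conj_stab (groupVr gA) hS; rewrite !permK.
  by rewrite /commute -{1 2}(conjgKV g h) -!conjMg (zC _ hS').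
by rewrite -conjMg zz conj1g.
Qed.

Lemma zed_neq1 x y : e x y -> exists2 z, z \in zed x y & z != 1.
Proof.
move=> xy; have pS := stab_pgroup xy.
have : 'Z(stab x y) != 1.
  rewrite center_nil_eq1 ?(pgroup_nil pS) //; have [t [tS _ tK _]] := tau xy.
  by apply: contra tK => /eqP S1; move: tS; rewrite S1 => /set1P->; exact: group1.
case/(pgroup_pdiv (pgroupS (center_sub _) pS))=> _ p_dvd _.
have [z zZ oz] := Cauchy (erefl _ : prime 2) p_dvd.
exists z; last by rewrite -order_eq1 oz.
case/setIP: zZ => zS /centP zC; apply/zedP; split=> //.
by rewrite -expg2 -oz expg_order.
Qed.

(** * Refutation of non-trivial edge kernels *)

Section KernelNontrivial.
Hypothesis knt : forall x y, e x y -> exists2 n, n \in nbfix x :&: nbfix y & n != 1.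

(** Otherwise, around every vertex [u], a central involution of [stab u w] swaps the other two
    neighbours [v] and [v']. It commutes with [nbfix u], so elements of [nbfix u :&: nbfix v] also
    lie in [nbfix v']; the edge kernels would spread over the graph, against [knt]. *)
Lemma zed_ker x y : e x y -> zed x y \subset nbfix x.
Proof.
move=> xy; apply/subsetP=> z zZ; apply/idPn=> zK.
have [n nK] := knt xy; case/eqP.
apply: (@family_trivial (fun u v => nbfix u :&: nbfix v) _ _ _ x y) => //.
- by move=> u v m _ /setIP[/nbfixP[]].
- by move=> u v _; rewrite setIC.
move=> u v v' uv uv' vv'; apply/subsetP=> m /setIP[mu mv].
have [w [uw wv wv' _]] := third uv uv' vv'.
have [g [gA gx gy]] := arc1_transitive xy uw.
have z'Z : z ^ g \in zed u w by rewrite -gx -gy zed_conj.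
have z'K : z ^ g \notin nbfix u by rewrite -gx conj_kerE.
case/zedP: z'Z => z'S z'C _.
have z'A : z ^ g \in A by case/stabP: z'S.
have z'v : (z ^ g) v = v'.
  have := stab_moves z'S uw z'K uv; rewrite eq_sym wv => /(_ isT).
  have [w' [uw' w'w w'v H]] := third uw uv wv.
  have z'u : (z ^ g) u = u by case/stabP: z'S.
  have : e u ((z ^ g) v) by rewrite -z'u graph_autE.
  have z'w : (z ^ g) w = w by case/stabP: z'S.
  case/H/or3P=> /eqP E; rewrite E ?eqxx // => _.
    by case/eqP: wv; apply: (@perm_inj _ (z ^ g)); rewrite E.
  by case/or3P: (H _ uv') => /eqP // E'; [case/eqP: wv' | case/eqP: vv'].
rewrite inE mu -z'v; have <- : m ^ (z ^ g) = m.
  by rewrite conjgE -(z'C m) ?mulKg // (subsetP (ker_stab uw)).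
by rewrite conj_ker.
Qed.

Definition vee x : {group {perm T}} := locked <<\bigcup_(y | e x y) zed x y>>%G.

Lemma zed_vee x y : e x y -> zed x y \subset vee x.
Proof. by move=> xy; rewrite /vee -lock sub_gen // (bigcup_max y). Qed.

(** Each generator lies in [nbfix x] by [zed_ker] and is central in some [stab x y], which contains
    [nbfix x]. *)
Lemma veeP x z : z \in vee x ->
  [/\ z \in nbfix x, forall k, k \in nbfix x -> commute z k & z * z = 1].
Proof.
move=> zV; apply/involZP; move: z zV; apply/subsetP.
rewrite /vee -lock gen_subG; apply/bigcupsP=> y xy; apply/subsetP=> z zZ.
apply/involZP; case/zedP: (zZ) => zS zC zz; split=> //.
  by rewrite (subsetP (zed_ker xy)).
by move=> k kK; apply: zC; rewrite (subsetP (ker_stab xy)).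
Qed.

Lemma vee_conj g x z : g \in A -> z \in vee x -> z ^ g \in vee (g x).
Proof.
move=> gA zV; have: z ^ g \in vee x :^ g by rewrite memJ_conjg.
move: (z ^ g); apply/subsetP; rewrite /vee -!lock -genJ gen_subG.
apply/subsetP=> h; rewrite mem_conjg => /bigcupP[y xy hZ].
rewrite mem_gen //; apply/bigcupP; exists (g y); first by rewrite graph_autE.
by rewrite -(conjgKV g h) zed_conj.
Qed.

Lemma vee_conjE g x z : g \in A -> (z ^ g \in vee (g x)) = (z \in vee x).
Proof.
move=> gA; apply/idP/idP; last exact: vee_conj.
by move/(@vee_conj g^-1 (g x)); rewrite groupV gA conjgK permK; apply.
Qed.

Lemma vee_sub_ker g x y : g \in A -> (vee (g x) \subset nbfix (g y)) = (vee x \subset nbfix y).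
Proof.
move=> gA; apply/idP/idP => /subsetP H; apply/subsetP=> z zV.
  by rewrite -(conj_kerE _ _ gA) H // vee_conj.
by rewrite -(conjgKV g z) conj_kerE // H // -(vee_conjE _ _ gA) conjgKV.
Qed.

(** Otherwise, by arc-transitivity, [zed u v] lies in [vee u] and hence in [zed u v'] for all
    neighbours, so [zed] spreads over the graph, against [zed_neq1]. *)
Lemma vee_zed x y : e x y -> ~~ (vee x \subset zed x y).
Proof.
move=> xy; apply/negP=> H; have [z zZ] := zed_neq1 xy; case/eqP.
apply: (@family_trivial zed _ _ _ x y) => //.
- by move=> u v n _ /zedP[/stabP[]].
- by move=> u v _; rewrite zedC.
move=> u v v' uv uv' _; apply/subsetP=> n /(subsetP (zed_vee uv)) nV.
have [g [gA gx gy]] := arc1_transitive xy uv'.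
rewrite -(conjgKV g n) -gx -gy zed_conj // (subsetP H) //.
by rewrite -(vee_conjE _ _ gA) conjgKV gx.
Qed.

(** [nbfix x] and [s] generate [stab x y], and [nbfix x] centralises [vee x]. If [s] did too,
    [vee x] would lie in [zed x y], against [vee_zed]. *)
Lemma vee_noncentral x y s : e x y -> s \in stab x y -> s \notin nbfix x ->
  exists2 v, v \in vee x & [~ v, s] != 1.
Proof.
move=> xy sS sK.
case: (boolP [exists v in vee x, [~ v, s] != 1]) => [/exists_inP//|].
rewrite negb_exists => /forallP H; case/negP: (vee_zed xy); apply/subsetP=> v vV.
have [vK vC vv] := veeP vV.
apply/zedP; split=> //; first by rewrite (subsetP (ker_stab xy)).
have vs : commute v s.
  by apply/commgP; have := H v; rewrite vV /= negbK.
move=> t tS; case: (boolP (t \in nbfix x)) => [/vC//|tK].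
have /vC : t * s^-1 \in nbfix x by rewrite (stab_mul_ker xy) ?groupV.
by move/commuteM/(_ vs); rewrite mulgKV.
Qed.

(* Otherwise the involution of [tau] is a product k * l * m with k in [vee x],
   l in [vee y] and m fixing both neighbourhoods, and then [stab x y] is abelian. *)
Lemma vee_ker1 x y : e x y -> vee x \subset nbfix y.
Proof.
move=> xy; apply/idPn=> H.
have nsub u v : e u v -> exists2 k, k \in vee u & k \notin nbfix v.
  move=> uv; have [g [gA gx gy]] := arc1_transitive xy uv.
  by apply/subsetPn; rewrite -gx -gy vee_sub_ker.
(* Squares spread along arcs: if [k] is not in [nbfix v'], multiply it by an involution [l] of
   [vee u] outside [nbfix v']; since [l] commutes with [k], the square is unchanged. *)
have sq1 m : m \in nbfix x :&: nbfix y -> m * m = 1.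
  move=> mK.
  apply: (@family_trivial (fun u v => [set k * k | k in nbfix u :&: nbfix v]) _ _ _ x y) => //.
  - by move=> u v n _ /imsetP[k /setIP[/nbfixP[kA ku _] _] ->]; rewrite permM !ku.
  - by move=> u v _; rewrite setIC.
  - move=> u v v' uv uv' _; apply/subsetP=> _ /imsetP[k /setIP[ku kv] ->].
    case: (boolP (k \in nbfix v')) => kv'; first by apply/imsetP; exists k; rewrite // inE ku.
    have [l lV lv'] := nsub u v' uv'; have [lK lC ll] := veeP lV.
    apply/imsetP; exists (k * l).
      rewrite inE groupM //=; apply: (@stab_mul_ker v' u) => //; first by rewrite e_sym.
        by rewrite (subsetP (ker_stab' uv')).
      by rewrite (subsetP (ker_stab' uv')).
    by rewrite mulgA -(mulgA k l k) (lC k) // mulgA -mulgA ll mulg1.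
  by apply: imset_f.
have yx : e y x by rewrite e_sym.
have [k kV ky] := nsub _ _ xy; have [l lV lx] := nsub _ _ yx.
have [kK kC kk] := veeP kV; have [lK lC ll] := veeP lV.
have [t [tS tt tx ty]] := tau xy.
have kS : k \in stab x y by rewrite (subsetP (ker_stab xy)).
have lS : l \in stab x y by rewrite (subsetP (ker_stab' yx)).
pose m := l^-1 * (k^-1 * t).
have mK : m \in nbfix x :&: nbfix y.
  have ktx : k^-1 * t \notin nbfix x by rewrite groupMl ?groupV.
  have kty : k^-1 * t \in nbfix y by rewrite (stab_mul_ker yx) ?groupV // stabC.
  rewrite inE; apply/andP; split; last by rewrite groupM ?groupV.
  by apply: (stab_mul_ker xy); rewrite ?groupV // groupM ?groupV.
have tE : t = k * l * m by rewrite /m mulgA mulgK mulKVg.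
have [mx my] := setIP mK.
(* As [m] commutes with [k * l], and [t] and [m] square to 1, so does [k * l]; hence the involutions
   [k] and [l] commute. *)
have kl : commute k l.
  have E : commute (k * l) m by apply/commute_sym/commuteM; apply/commute_sym;
    [exact: kC|exact: lC].
  have : (k * l * m) ^+ 2 = 1 by rewrite -tE expg2.
  rewrite expgMn // !expg2 (sq1 m) // mulg1 => /(canRL (mulgK _)).
  by rewrite mul1g invMg !invol_inv.
have [v vV] := vee_noncentral xy tS tx; case/negP; apply/commgP.
have [vK vC vv] := veeP vV.
rewrite tE; apply: commuteM; last exact: vC.
apply: commuteM; first exact: vC.
(* Either [v] or [k^-1 * v] lies in [nbfix y], with which [l] commutes. *)
case: (boolP (v \in nbfix y)) => vy; first by apply/commute_sym/lC.
have vkS : k^-1 * v \in nbfix y.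
  by rewrite (stab_mul_ker yx) ?groupV // (subsetP (ker_stab' xy)).
rewrite -(mulKVg k v); apply/commute_sym/commuteM; first exact/commute_sym.
exact: lC.
Qed.

(** * Arcs and commutator sets *)

Definition narc n (x : nat -> T) :=
  (forall i, i < n -> e (x i) (x i.+1)) /\ (forall i, i.+1 < n -> x i != x i.+2).

Lemma narc_shift n m k x : narc n x -> k + m <= n -> narc m (fun i => x (k + i)%N).
Proof.
move=> [H1 H2] le; split=> i im; rewrite ?addnS.
  by apply: H1; apply: leq_trans le; rewrite ltn_add2l.
by apply: H2; rewrite -addnS; apply: leq_trans le; rewrite ltn_add2l.
Qed.

Lemma narc_sub n m x : narc n x -> m <= n -> narc m x.
Proof.
move=> [H1 H2] le; split=> i im; [apply: H1 | apply: H2]; exact: leq_trans im le.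
Qed.

Lemma narc_rev n x : narc n x -> narc n (fun i => x (n - i)%N).
Proof.
move=> [H1 H2]; split=> i im.
  by rewrite e_sym -(subnSK im); apply: H1; rewrite ltn_subrL (leq_ltn_trans _ im).
rewrite eq_sym -(subnSK (ltnW im)) -(subnSK im); apply: H2.
by rewrite subnSK // ltn_subrL (leq_ltn_trans _ im).
Qed.

Lemma narc_ext n x z : narc n.+1 x -> e (x n.+1) z -> x n != z ->
  narc n.+2 (fun i => if i <= n.+1 then x i else z).
Proof.
move=> [H1 H2] xz nz; split=> i le.
  rewrite -ltnS le; case: (ltnP i n.+1) => [|le']; first exact: H1.
  by have -> : i = n.+1 by apply/eqP; rewrite eqn_leq le' -ltnS le.
have le2 : i <= n.+1 by rewrite ltnW // -ltnS ltnW.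
rewrite le2; case: (ltnP i.+1 n.+1) => [|le']; first exact: H2.
by have -> : i = n by apply/eqP; rewrite eqn_leq -ltnS -(ltnS n) le' -ltnS le.
Qed.

Lemma narc_map g n x : g \in A -> narc n x -> narc n (fun i => g (x i)).
Proof.
move=> gA [H1 H2]; split=> i im; first by rewrite graph_autE // H1.
by rewrite (inj_eq perm_inj) H2.
Qed.

Lemma next_narc x y : e x y -> exists2 z, e y z & x != z.
Proof.
rewrite e_sym => /other2[u [_ [[xu _ uy _ _] _]]]; exists u => //.
by rewrite eq_sym.
Qed.

(** The bare set of commutators, not the subgroup they generate. At the critical length 2 it has a
    single non-trivial element, see [comms_uniq]. *)
Definition comms x y := [set [~ v, s] | v in vee x, s in stab x y].

Lemma comm_vee x v s : v \in vee x -> s \in A -> s x = x -> [~ v, s] \in vee x.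
Proof. by move=> vV sA sx; rewrite commgEl groupM ?groupV //; rewrite -[X in vee X]sx vee_conj. Qed.

Lemma comms_vee x y : comms x y \subset vee x.
Proof.
by apply/subsetP=> _ /imset2P[v s vV /stabP[sA sx _] ->]; exact: comm_vee.
Qed.

Lemma comms_conj g x y r : g \in A -> r \in comms x y -> r ^ g \in comms (g x) (g y).
Proof.
move=> gA /imset2P[v s vV sS ->]; rewrite conjRg; apply/imset2P.
by exists (v ^ g) (s ^ g); rewrite ?vee_conj ?conj_stab.
Qed.

Lemma comms_neq1 x y : e x y -> exists2 r, r \in comms x y & r != 1.
Proof.
move=> xy; have [t [tS _ tx _]] := tau xy.
have [v vV ne] := vee_noncentral xy tS tx.
by exists [~ v, t] => //; apply/imset2P; exists v t.
Qed.

(** * Arcs of critical length *)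

Section Critical.
Variable b : nat.
Hypothesis b_ge2 : 1 < b.
Hypothesis subcrit : forall n x, n < b -> narc n x -> vee (x 0) \subset nbfix (x n).
Variable c : nat -> T.
Hypothesis c_arc : narc b c.
Hypothesis c_crit : ~~ (vee (c 0) \subset nbfix (c b)).

Let b_gt0 : 0 < b. Proof. exact: ltnW. Qed.
Let bP : b.-1.+1 = b. Proof. exact: prednK. Qed.

Lemma vee_fix_arc x a i : narc b x -> a \in vee (x 0) -> i <= b -> a (x i) = x i.
Proof.
move=> xb aV; case: i => [|i] ib; first by case/veeP: aV => /nbfixP[].
have /subsetP/(_ _ aV)/nbfixP[_ _] := subcrit ib (narc_sub xb (ltnW ib)).
by apply; exact: (xb.1).
Qed.

(** Induction on the length. Both arcs, without their last vertex, are moved onto the end of [c]. An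
    element of [vee (c 0)] outside [nbfix (c b)] fixes the arc [c] and swaps the two ways of
    prolonging it, which adjusts the last vertex. *)
Lemma narc_transitive n x y : n <= b -> narc n x -> narc n y ->
  exists2 g, g \in A & forall i, i <= n -> g (x i) = y i.
Proof.
elim: n x y => [|n IH] x y nb xn yn.
  have [g gA gx] := vt (x 0) (y 0); exists g => // i.
  by rewrite leqn0 => /eqP->.
have [xn' yn'] := (narc_sub xn (leqnSn n), narc_sub yn (leqnSn n)).
case: n => [|n] in IH nb xn yn xn' yn' *.
  have [g [gA gx gy]] := arc1_transitive (xn.1 0 isT) (yn.1 0 isT); exists g => // i.
  by case: i => [|[|]].
pose l i := c (b - n.+1 + i)%N.
have ln : narc n.+1 l by apply: (narc_shift c_arc); rewrite subnK // ltnW.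
have lE : l n.+1 = c b by rewrite /l subnK // ltnW.
have [g gA gx] := IH x l (ltnW nb) xn' ln.
have [h hA hy] := IH y l (ltnW nb) yn' ln.
have /subsetPn[a aV aK] := c_crit.
have aA : a \in A by case/veeP: aV => /nbfixP[].
have afix i : i <= n.+1 -> a (l i) = l i.
  move=> le; apply: (vee_fix_arc c_arc aV).
  by rewrite -{2}(@subnK n.+1 b) ?leq_add2l // ltnW.
have lu : e (l n.+1) (l n) by rewrite e_sym; exact: (ln.1).
have aS : a \in stab (l n.+1) (l n) by apply/stabP; rewrite !afix.
have aK' : a \notin nbfix (l n.+1) by rewrite lE.
have [u gu] : exists u, g (x n.+2) = u by eexists.
have [u' hu'] : exists u', h (y n.+2) = u' by eexists.
have nu : u != l n.
  by rewrite -gu -(gx n) // (inj_eq perm_inj) eq_sym (xn.2 n).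
have nu' : u' != l n.
  by rewrite -hu' -(hy n) // (inj_eq perm_inj) eq_sym (yn.2 n).
have eu : e (l n.+1) u by rewrite -gu -(gx n.+1) // graph_autE // (xn.1 n.+1).
have eu' : e (l n.+1) u' by rewrite -hu' -(hy n.+1) // graph_autE // (yn.1 n.+1).
have au := stab_moves aS lu aK' eu nu.
have [k kA [kfix ku]] : exists2 k, k \in A & (forall i, i <= n.+1 -> k (l i) = l i) /\ k u = u'.
  have [<-|uu'] := eqVneq u u'.
    by exists 1; rewrite ?group1 //; split=> *; rewrite perm1.
  exists a => //; split=> //.
  have [w [ew wu wl H]] := third eu lu nu.
  have : e (l n.+1) (a u) by rewrite -(afix n.+1) // graph_autE.
  case/H/or3P=> /eqP E; first by rewrite E eqxx in au.
    by case/eqP: nu; apply: (@perm_inj _ a); rewrite E afix.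
  case/H/or3P: eu' => /eqP E'; last by rewrite E.
    by rewrite E' eqxx in uu'.
  by rewrite E' eqxx in nu'.
exists (g * k * h^-1); first by rewrite !groupM ?groupV.
move=> i; rewrite leq_eqVlt => /predU1P[->|]; last first.
  by rewrite ltnS => le; rewrite !permM gx // kfix // -hy // permK.
by rewrite !permM gu ku -hu' permK.
Qed.

Lemma narc_crit x : narc b x -> ~~ (vee (x 0) \subset nbfix (x b)).
Proof.
move=> xb; have [g gA gx] := narc_transitive (leqnn _) c_arc xb.
by rewrite -!gx // vee_sub_ker.
Qed.

Lemma vee_sub_stab x : narc b x -> vee (x 0) \subset stab (x b) (x b.-1).
Proof.
move=> xb; apply/subsetP=> a aV; apply/stabP; split; first by case/veeP: aV => /nbfixP[].
  exact: (vee_fix_arc xb aV).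
by apply: (vee_fix_arc xb aV); rewrite leq_pred.
Qed.

Lemma vee_sub_stab' x : narc b x -> vee (x b) \subset stab (x 0) (x 1%N).
Proof.
by move/narc_rev/vee_sub_stab; rewrite subn0 subnn -subn1 subKn.
Qed.

Lemma narc_last x : narc b x -> e (x b) (x b.-1).
Proof. by move=> xb; rewrite e_sym -{2}bP; apply: (xb.1); rewrite bP. Qed.

(** [v] and [v'] differ by an element of [nbfix (x b)], which commutes with [vee (x b)]; [t] and
    [t'] differ by an element of [nbfix (x 0)], which commutes with [vee (x 0)]. The commutators lie
    in [vee (x 0)], so the conjugations left over are trivial. *)
Lemma comm_const x v v' t t' : narc b x ->
  v \in vee (x 0) -> v' \in vee (x 0) -> v \notin nbfix (x b) -> v' \notin nbfix (x b) ->
  t \in vee (x b) -> t' \in vee (x b) -> t \notin nbfix (x 0) -> t' \notin nbfix (x 0) ->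
  [~ v, t] = [~ v', t'].
Proof.
move=> xb vV v'V vK v'K tV t'V tK t'K.
have S0 := subsetP (vee_sub_stab xb); have Sb := subsetP (vee_sub_stab' xb).
have x01 := xb.1 0 b_gt0.
have cV s : s \in vee (x b) -> [~ v, s] \in vee (x 0).
  by move=> /Sb /stabP[sA s0 _]; exact: comm_vee.
pose k := v^-1 * v'.
have kV : k \in vee (x 0) by rewrite groupM ?groupV.
have kK : k \in nbfix (x b) by rewrite (stab_mul_ker (narc_last xb)) ?groupV ?S0.
pose m := t^-1 * t'.
have mK : m \in nbfix (x 0) by rewrite (stab_mul_ker x01) ?groupV ?Sb.
rewrite -(mulKVg v v') -/k commMgJ.
have [_ /(_ _ kK) kt' _] := veeP t'V.
have /commgP/eqP -> : commute k t' by apply: commute_sym.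
rewrite mulg1; have [kK0 _ _] := veeP kV.
have [_ /(_ _ kK0) H _] := veeP (cV _ t'V).
rewrite conjgE H mulKg -(mulKVg t t') -/m commgMJ.
have [_ vC _] := veeP vV; have /commgP/eqP -> := vC _ mK.
have [_ /(_ _ mK) H' _] := veeP (cV _ tV).
by rewrite mul1g conjgE H' mulKg.
Qed.

(** Modulo [nbfix (x 0)], which centralises [vee (x 0)], the group [stab (x 0) (x 1)] has only the
    classes of 1 and of some [t0] in [vee (x b)], found by [narc_crit] on the reversed arc. *)
Lemma commsE x : narc b x ->
  comms (x 0) (x 1%N) = [set [~ v, t] | v in vee (x 0), t in vee (x b)].
Proof.
move=> xb; apply/eqP; rewrite eqEsubset; apply/andP; split; last first.
  by apply: imset2S => //; exact: vee_sub_stab'.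
have x01 := xb.1 0 b_gt0.
have /subsetPn[t0 t0V t0K] := narc_crit (narc_rev xb).
rewrite subn0 subnn in t0V t0K; have t0S := subsetP (vee_sub_stab' xb) _ t0V.
apply/subsetP=> _ /imset2P[v s vV sS ->].
have [vK vC vv] := veeP vV; apply/imset2P.
case: (boolP (s \in nbfix (x 0))) => [/vC/commgP/eqP->|sK].
  by exists 1 1; rewrite ?group1 // comm1g.
exists v t0 => //; rewrite -(mulKVg t0 s) commgMJ.
have kK : t0^-1 * s \in nbfix (x 0) by rewrite (stab_mul_ker x01) ?groupV.
have /commgP/eqP -> := vC _ kK; rewrite mul1g.
have t0V' : [~ v, t0] \in vee (x 0) by case/stabP: t0S => *; exact: comm_vee.
by have [_ /(_ _ kK) H _] := veeP t0V'; rewrite conjgE H mulKg.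
Qed.

(** By [commsE] both sides consist of commutators of [vee (x 0)] and [vee (x b)]; reversing the arc
    inverts them, and each is its own inverse. *)
Lemma comms_ends x : narc b x -> comms (x 0) (x 1%N) = comms (x b) (x b.-1).
Proof.
have main y : narc b y -> comms (y 0) (y 1%N) \subset comms (y b) (y b.-1).
  move=> yb; have rb := narc_rev yb; have := commsE rb.
  rewrite subn0 subnn subn1 => ->; rewrite commsE //.
  apply/subsetP=> _ /imset2P[v t vV tV ->]; apply/imset2P; exists t v => //.
  have /stabP[tA t0 _] := subsetP (vee_sub_stab' yb) _ tV.
  have [_ _ /invol_inv <-] := veeP (comm_vee vV tA t0).
  by rewrite invg_comm.
move=> xb; apply/eqP; rewrite eqEsubset main //=.
by have := main _ (narc_rev xb); rewrite subn0 subnn subn1 -subn1 subKn.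
Qed.

Lemma narc_through j x y z : 1 < j -> j <= b -> e z x -> e x y -> z != y ->
  exists d, [/\ narc b d, d j.-2 = z, d j.-1 = x & d j = y].
Proof.
case: j => [|[|j]] //= _ jb zx xy zy.
have a2 : narc 2 (fun i => nth z [:: z; x; y] i) by split=> -[|[|]].
have c2 : narc 2 (fun i => c (j + i)%N) by apply: (narc_shift c_arc); rewrite addn2.
have [g gA gE] := narc_transitive b_ge2 c2 a2.
exists (fun i => g (c i)); split; first exact: narc_map.
- by have := gE 0 isT; rewrite addn0.
- by have := gE 1%N isT; rewrite addn1.
by have := gE 2 isT; rewrite addn2.
Qed.

(** Two arcs of length [b] ending in [z, x, y] and in [z, x, y'] share their first two vertices, as
    [b] is at least 2, and [comms_ends] reads both sets off this common start. *)
Lemma comms_indep x y y' : e x y -> e x y' -> comms y x = comms y' x.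
Proof.
move=> xy xy'; have [->//|yy'] := eqVneq y y'.
have [z [xz zy zy' _]] := third xy xy' yy'.
have zx : e z x by rewrite e_sym.
have [d [db dz dx dy]] := narc_through b_ge2 (leqnn b) zx xy zy.
rewrite -{1}dy -{1}dx -comms_ends //.
pose d' i := if i < b then d i else y'.
have db' : narc b d'.
  rewrite /d'; have [m bm] : exists m, b = m.+2 by case: (b) b_ge2 => [|[|m]] // _; exists m.
  rewrite bm; apply: narc_ext; first by apply: (narc_sub db); rewrite bm.
    by rewrite bm in dx; rewrite dx.
  by rewrite bm in dz; rewrite dz.
have := comms_ends db'; rewrite /d' b_gt0 b_ge2 ltnn ltn_predL b_gt0.
by rewrite dx => ->.
Qed.

(** Two arcs branching at [x], now two steps before their ends, still share their first two vertices
    because [b > 2]; [comms_indep] turns the sets at their ends into the two sides. *)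
Lemma comms_far x y y' : 2 < b -> e x y -> e x y' -> comms x y = comms x y'.
Proof.
move=> b_ge3 xy xy'; have [->//|yy'] := eqVneq y y'.
have [z [xz zy zy' _]] := third xy xy' yy'.
have zx : e z x by rewrite e_sym.
have bm : b = (b - 3).+3 by rewrite -addn3 subnK.
move: (b - 3)%N bm => m bm.
have j2 : 1 < b.-1 by rewrite bm.
have [d [db dz dx dy]] := narc_through j2 (leq_pred b) zx xy zy.
rewrite bm /= in dz dx dy.
have [w yw xw] := next_narc xy'.
pose d1 i := if i <= m.+1 then d i else y'.
have d1b : narc m.+2 d1.
  rewrite /d1; apply: narc_ext; first by apply: (narc_sub db); rewrite bm; do 2 apply: leqW.
    by rewrite dx.
  by rewrite dz.
pose d' i := if i <= m.+2 then d1 i else w.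
have db' : narc m.+3 d'.
  rewrite /d'; apply: narc_ext => //; first by rewrite /d1 ltnn.
  by rewrite /d1 leqnn dx.
have yx : e y x by rewrite e_sym.
have yx' : e y' x by rewrite e_sym.
have yd : e y (d b) by rewrite -dy bm; apply: (db.1); rewrite bm.
rewrite (comms_indep yx yd) (comms_indep yx' yw).
have := comms_ends db; have := comms_ends (x := d'); rewrite bm /= => /(_ db').
by rewrite /d' /d1 /= ltnn leqnn ltnn dy => <- <-.
Qed.

(** For [b > 2] either argument of [comms] may be replaced by another neighbour of the other one.
    The unions [comms u v :|: comms v u] then spread over the graph, so their elements fix every
    vertex, against [comms_neq1]. *)
Lemma critical_le2 : b <= 2.
Proof.
rewrite leqNgt; apply/negP=> b_ge3.
have c01 := c_arc.1 0 b_gt0; have [r rR] := comms_neq1 c01; case/eqP.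
apply: (@family_trivial (fun u v => comms u v :|: comms v u) _ _ _ (c 0) (c 1%N)) => //.
- move=> u v n uv /setUP[/(subsetP (comms_vee _ _))/veeP[/nbfixP[]]//|].
  move/(subsetP (comms_vee _ _))/veeP=> [/nbfixP[_ _ fx] _ _]; apply: fx.
  by rewrite e_sym.
- by move=> u v _; rewrite setUC.
- by move=> u v v' uv uv' _; rewrite (comms_far b_ge3 uv uv') (comms_indep uv uv').
by rewrite inE rR.
Qed.

Lemma critical_eq2 : b = 2.
Proof. by apply/eqP; rewrite eqn_leq critical_le2. Qed.

Lemma vee_crit2 x y z : e x y -> e y z -> x != z -> ~~ (vee x \subset nbfix z).
Proof.
move=> xy yz xz; have a2 : narc b (fun i => nth x [:: x; y; z] i).
  by rewrite critical_eq2; split=> -[|[|]].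
by have := narc_crit a2; rewrite critical_eq2.
Qed.

(** Along a 2-arc, a non-trivial commutator comes from elements outside the opposite kernels, and
    [comm_const] makes all of these agree. *)
Lemma comms_uniq x y r r' : e x y -> r \in comms y x -> r' \in comms y x ->
  r != 1 -> r' != 1 -> r = r'.
Proof.
move=> xy; have yx : e y x by rewrite e_sym.
have [z xz yz] := next_narc yx.
have a2 : narc b (fun i => nth y [:: y; x; z] i) by rewrite critical_eq2; split=> -[|[|]].
have := commsE a2; rewrite /= => ->; rewrite critical_eq2 /=.
case/imset2P=> v t vV tV -> /imset2P[v' t' v'V t'V ->].
have ne u s : u \in vee y -> s \in vee z -> [~ u, s] != 1 ->
    u \notin nbfix z /\ s \notin nbfix y.
  move=> /veeP[_ uC _] /veeP[_ sC _] H; split; apply: contra H => H; apply/commgP.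
    exact/commute_sym/sC.
  exact: uC.
move=> /(ne _ _ vV tV)[vz ty] /(ne _ _ v'V t'V)[v'z t'y].
by have := comm_const a2 (v := v) (v' := v') (t := t) (t' := t'); rewrite critical_eq2 /=; apply.
Qed.

(* By [comms_indep] the choice of y is irrelevant, and by [comms_uniq] r is unique. *)
Definition root x r := r != 1 /\ exists2 y, e x y & r \in comms y x.

Lemma root_comms x r y : root x r -> e x y -> r \in comms y x.
Proof. by move=> [_ [z xz rR]] xy; rewrite (comms_indep xy xz). Qed.

Lemma root_vee x r y : root x r -> e x y -> r \in vee y.
Proof. by move=> rr xy; rewrite (subsetP (comms_vee y x)) // root_comms. Qed.

Lemma root_uniq x r r' : root x r -> root x r' -> r = r'.
Proof.
move=> rr [ne [y xy rR]]; case: (rr) => ne' _.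
by apply: (comms_uniq xy) => //; exact: root_comms.
Qed.

Lemma root_conj g x r : g \in A -> root x r -> root (g x) (r ^ g).
Proof.
move=> gA [ne [y xy rR]]; split; first by rewrite conjg_eq1.
by exists (g y); [rewrite graph_autE | rewrite comms_conj].
Qed.

(** Some [a] in [zed y w], with [w] the third neighbour of [y], is outside [nbfix z]. If [s] fixes
    [y] and [x] and takes [w] to [u], then [a ^ s] lies in [zed y u], hence in [nbfix z]. So
    [[~ a, s]] is outside [nbfix z], and by uniqueness it is the root of [x]. *)
Lemma root_moves x y u z r : root x r -> e x y -> x != u -> e y u -> e u z -> y != z ->
  r \notin nbfix z.
Proof.
move=> rr xy xu yu uz yz.
have yx : e y x by rewrite e_sym.
have [w [yw wx wu H]] := third yx yu xu.
have uy : e u y by rewrite e_sym.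
have Zu : zed y u \subset nbfix z.
  by rewrite zedC; apply: subset_trans (zed_vee uy) (vee_ker1 uz).
have comms_u s : s \in comms y u -> s \in nbfix z.
  rewrite (comms_indep uy uz) => /(subsetP (comms_vee _ _)).
  by case/veeP.
have [a aZ aK] : exists2 a, a \in zed y w & a \notin nbfix z.
  have := vee_crit2 yu uz yz; rewrite /vee -{1}lock gen_subG => /subsetPn[a].
  case/bigcupP=> v yv aZ aK; case/or3P: (H _ yv) => /eqP E; rewrite {v}E in yv aZ.
  (* A generator in [zed y x] is moved into [zed y w] by swapping [x] and [w]; it changes only by an
     element of [comms y u], which lies in [nbfix z]. *)
  - have [s [sS _ sy _]] := tau yu; case/stabP: (sS) => sA sy' su.
    have sx : s x = w.
      have ne := stab_moves sS yu sy yx xu.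
      have : e y (s x) by rewrite -sy' graph_autE.
      case/H/or3P=> /eqP E //; first by rewrite E eqxx in ne.
      by case/eqP: xu; apply: (@perm_inj _ s); rewrite E su.
    exists (a ^ s); first by rewrite -sy' -sx zed_conj.
    rewrite -(mulKVg a (a ^ s)) -commgEl groupMr //.
    by apply: comms_u; apply/imset2P; exists a s => //; rewrite (subsetP (zed_vee yx)).
  - by case/negP: aK; rewrite (subsetP Zu).
  by exists a.
have [s [sS _ sy _]] := tau yx; case/stabP: (sS) => sA sy' sx.
have sw : s w = u.
  have ne := stab_moves sS yx sy yw wx.
  have : e y (s w) by rewrite -sy' graph_autE.
  case/H/or3P=> /eqP E //; last by rewrite E eqxx in ne.
  by case/eqP: wx; apply: (@perm_inj _ s); rewrite E sx.
have asK : a ^ s \in nbfix z by apply: (subsetP Zu); rewrite -sy' -sw zed_conj.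
have cK : [~ a, s] \notin nbfix z by rewrite commgEl groupMr // groupV.
have -> // : r = [~ a, s].
apply: (root_uniq rr); split.
  by apply: contra cK => /eqP->; rewrite group1.
by exists y => //; apply/imset2P; exists a s => //; rewrite (subsetP (zed_vee yw)).
Qed.

(** By [root_moves], [r] and [r'] lie outside the kernels of [y'] and [y], so [comm_const]
    identifies their commutator with the non-trivial element of [comms y u], the root of [u]. *)
Lemma root_comm x y u y' x' r r' s : root x r -> root x' r' -> root u s ->
  e x y -> e y u -> e u y' -> e y' x' -> x != u -> y != y' -> u != x' ->
  [~ r, r'] = s.
Proof.
move=> rr rr' rs xy yu uy' yx' xu yy' ux'.
have uy : e u y by rewrite e_sym.
have xy' : e x' y' by rewrite e_sym.
have yu' : e y' u by rewrite e_sym.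
have rK := root_moves rr xy xu yu uy' yy'.
have rK' : r' \notin nbfix y.
  by apply: (root_moves rr' xy' _ yu' uy); rewrite eq_sym.
have rV := root_vee rr xy; have rV' := root_vee rr' xy'.
have a2 : narc b (fun i => nth y [:: y; u; y'] i) by rewrite critical_eq2; split=> -[|[|]].
have := root_comms rs uy; have := commsE a2; rewrite /= => ->; rewrite critical_eq2 /=.
case/imset2P=> v t vV tV sE; rewrite sE.
have := comm_const a2 (v := r) (v' := v) (t := r') (t' := t); rewrite critical_eq2 /=; apply => //.
  apply: contra rs.1 => vK; rewrite sE; apply/commgP/commute_sym.
  by have [_ tC _] := veeP tV; exact: tC.
apply: contra rs.1 => tK; rewrite sE; apply/commgP.
by have [_ vC _] := veeP vV; exact: vC.
Qed.

Lemma root_exists x : exists r, root x r.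
Proof.
have : [set y | e x y] != set0 by rewrite -card_gt0 e_cubic.
case/set0Pn=> y; rewrite inE => xy; have yx : e y x by rewrite e_sym.
by have [r rR r1] := comms_neq1 yx; exists r; split=> //; exists y.
Qed.

(* Let r_i be the root of the vertex p_i of a 5-arc.  The square of
   [r5 * r5 ^ r0 = (r5 * r0) ^+ 2] is r3, that of [r0 * r0 ^ r5] is r2, and the
   two elements are inverse to each other. *)
Lemma critical_false : False.
Proof.
have p23 := c_arc.1 0 b_gt0; set p2 := c 0 in p23; set p3 := c 1%N in p23.
have p32 : e p3 p2 by rewrite e_sym.
have [p4 p34 n24] := next_narc p23; have [p5 p45 n35] := next_narc p34.
have [p1 p21 n31] := next_narc p32; have [p0 p10 n20] := next_narc p21.
have p01 : e p0 p1 by rewrite e_sym.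
have p12 : e p1 p2 by rewrite e_sym.
have p43 : e p4 p3 by rewrite e_sym.
have p54 : e p5 p4 by rewrite e_sym.
have [n42 [n53 [n13 n02]]] : p4 != p2 /\ (p5 != p3 /\ (p1 != p3 /\ p0 != p2)).
  by do !split; rewrite eq_sym.
have [r0 R0] := root_exists p0; have [r5 R5] := root_exists p5.
have [r2 R2] := root_exists p2; have [r3 R3] := root_exists p3.
have r0V := root_vee R0 p01; have r5V := root_vee R5 p54.
have [/nbfixP[r0A _ _] _ r0r0] := veeP r0V; have [/nbfixP[r5A _ _] _ r5r5] := veeP r5V.
have r0K2 := subsetP (vee_ker1 p12) _ r0V; have r5K3 := subsetP (vee_ker1 p43) _ r5V.
have r0K3 := root_moves R0 p01 n02 p12 p23 n13.
have r5K2 := root_moves R5 p54 n53 p43 p32 n42.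
have r0S := subsetP (ker_stab' p23) _ r0K2; have r5S := subsetP (ker_stab' p32) _ r5K3.
have m4 := stab_moves r0S p32 r0K3 p34 n42.
have m1 := stab_moves r5S p23 r5K2 p21 n13.
have [_ r0p3 r0p2] := stabP _ _ _ r0S; have [_ r5p2 r5p3] := stabP _ _ _ r5S.
(* [r0] fixes [p3] and moves [p4], so [p5], [p4], [p3] and the images of [p4], [p5] form an arc
   centred at [p3]. *)
have E3 : [~ r5, r5 ^ r0] = r3.
  apply: (@root_comm p5 p4 p3 (r0 p4) (r0 p5)) => //; first exact: root_conj.
  - by rewrite -{1}r0p3 graph_autE.
  - by rewrite graph_autE.
  - by rewrite eq_sym.
  by rewrite -{1}r0p3 (inj_eq perm_inj).
have E2 : [~ r0, r0 ^ r5] = r2.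
  apply: (@root_comm p0 p1 p2 (r5 p1) (r5 p0)) => //; first exact: root_conj.
  - by rewrite -{1}r5p2 graph_autE.
  - by rewrite graph_autE.
  - by rewrite eq_sym.
  by rewrite -{1}r5p2 (inj_eq perm_inj).
have r23 : r2 = r3.
  have [_ _ r2r2] := veeP (root_vee R2 p21).
  rewrite -(invol_inv r2r2) -E2 -E3 commgEl conjgE commgEl conjgE.
  by rewrite !conjgE !invMg !(invol_inv r0r0) !(invol_inv r5r5) !mulgA.
(* By arc-transitivity [r23] makes the roots of any two adjacent vertices equal, so [r2] fixes every
   vertex. *)
case/eqP: (R2.1).
apply: (@family_trivial (fun u v => comms v u) _ _ _ p2 p3) => //.
- move=> u v n uv /(subsetP (comms_vee _ _))/veeP[/nbfixP[_ _ fx] _ _].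
  by apply: fx; rewrite e_sym.
- move=> u v uv; apply/subsetP=> r rR; have [->|r1] := eqVneq r 1.
    by apply/imset2P; exists 1 1; rewrite ?group1 ?comm1g.
  have Ru : root u r by split=> //; exists v.
  have [g [gA gu gv]] := arc1_transitive p23 uv.
  have rE : r = r2 ^ g by apply: (root_uniq Ru); rewrite -gu; exact: root_conj.
  by rewrite rE r23 -gv -gu comms_conj // root_comms.
- by move=> u v v' uv uv' _; rewrite (comms_indep uv uv').
exact: root_comms.
Qed.

End Critical.

(** A shortest counterexample would be a critical arc: lengths 0 and 1 are settled by [veeP] and
    [vee_ker1], greater ones by [critical_false]. *)
Lemma vee_ker_arc n x : narc n x -> vee (x 0) \subset nbfix (x n).
Proof.
elim/ltn_ind: n x => -[|[|n]] IH x xn.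
- by apply/subsetP=> z /veeP[].
- by apply: vee_ker1; exact: (xn.1).
apply/idPn=> H; apply: (critical_false (b := n.+2) _ _ xn H) => //.
by move=> m y mn; exact: IH.
Qed.

(** A path without repetition is an arc, so by [vee_ker_arc] the elements of [zed x y] fix every
    vertex, against [zed_neq1]. *)
Lemma kernel_nontrivial_false x y : ~ e x y.
Proof.
move=> xy; have [z zZ] := zed_neq1 xy; case/eqP; apply/permP=> w; rewrite perm1.
have zV := subsetP (zed_vee xy) _ zZ.
have /connectP[p0 p0P ->] := e_conn x w; case/shortenP: p0P => p pP pU _.
have xn : narc (size p) (fun i => nth x (x :: p) i).
  split=> i ip; first by move/pathP: pP; apply.
  by rewrite nth_uniq //= ?ltnS ?(ltnW (ltnW ip)) // neq_ltn leqW.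
have /subsetP/(_ _ zV)/nbfixP[_] := vee_ker_arc xn.
by rewrite nth_last /=.
Qed.

End KernelNontrivial.

Lemma ker_edge_trivial x y n : e x y -> n \in nbfix x -> n \in nbfix y -> n = 1.
Proof.
move=> xy nx ny; apply/eqP/idPn=> n1; apply: (@kernel_nontrivial_false _ x y xy) => u v uv.
have [g [gA gx gy]] := arc1_transitive xy uv.
by exists (n ^ g); rewrite ?conjg_eq1 // inE -gx -gy !conj_ker.
Qed.

(** * Rotations of order 3 at a vertex *)

Lemma perm_cube1 (f : {perm T}) y : f ^+ 3 = 1 -> f (f (f y)) = y.
Proof. by move=> f3; rewrite -[RHS]perm1 -f3 !expgS mulg1 !permM. Qed.

Definition rotation3 x (c : {perm T}) :=
  [/\ c \in A, c x = x, forall y, e x y -> c y != y & c ^+ 3 = 1].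

Lemma rotation3_cycle x c y : rotation3 x c -> e x y ->
  [/\ e x (c y), c (c y) != y & forall z, e x z -> [|| z == y, z == c y | z == c (c y)]].
Proof.
case=> cA cx cm _ xy; have xe z : e x z -> e x (c z) by move=> xz; rewrite -cx graph_autE.
have xcy := xe _ xy; have ycy : y != c y by rewrite eq_sym cm.
have [u [xu uy ucy H]] := third xy xcy ycy.
have cc : c (c y) != y.
  apply/eqP=> E; case/or3P: (H _ (xe _ xu)) => /eqP E'.
  - by case/eqP: ucy; apply: (@perm_inj _ c); rewrite E' E.
  - by case/eqP: uy; apply: (@perm_inj _ c); rewrite E'.
  by case/eqP: (cm _ xu).
split=> // z /H.
case/or3P: (H _ (xe _ xcy)) => /eqP E; rewrite E ?eqxx // in cc *.
by case/eqP: (cm _ xcy).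
Qed.

(** The quotient [k] of [c] and [d] lies in [nbfix x], which acts faithfully around [y] by
    [ker_edge_trivial] and so has order at most 2. As [d] normalises it, [k] commutes with [d];
    comparing cubes gives [k ^+ 3 = 1], while [k * k = 1]. *)
Lemma rotation3_agree x y c d : rotation3 x c -> rotation3 x d -> e x y ->
  c y = d y -> c = d.
Proof.
move=> cr dr xy cdy.
have [xcy ccy cH] := rotation3_cycle cr xy; have [xdy ddy dH] := rotation3_cycle dr xy.
case: (cr) => cA cx cm c3; case: (dr) => dA dx dm d3.
have ccdd : c (c y) = d (d y).
  have xccy : e x (c (c y)) by rewrite -{1}cx graph_autE.
  case/or3P: (dH _ xccy) => /eqP //; first by move/eqP; rewrite (negPf ccy).
  by rewrite -cdy => /eqP; rewrite (negPf (cm _ xcy)).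
pose k := c * d^-1.
have cE : c = k * d by rewrite mulgKV.
have kx : k \in nbfix x.
  have cdE z : c z = d z -> k z = z by rewrite permM => ->; rewrite permK.
  apply/nbfixP; split; [by rewrite groupM ?groupV | by rewrite cdE // dx |].
  move=> z /cH /or3P[]/eqP->; apply: cdE => //; first by rewrite ccdd cdy.
  by rewrite perm_cube1 // ccdd perm_cube1.
have yx : e y x by rewrite e_sym.
have [k1|k1] := eqVneq k 1; first by rewrite cE k1 mul1g.
have ker_inv l : l \in nbfix x -> l != 1 -> k * l = 1.
  move=> lx l1; apply: (ker_edge_trivial xy); first by rewrite groupM.
  have nk h : h \in nbfix x -> h != 1 -> h \notin nbfix y.
    by move=> hx; apply: contra => hy; rewrite (ker_edge_trivial xy hx hy).
  by apply: (stab_mul_ker yx); rewrite ?(subsetP (ker_stab' xy)) ?nk.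
have kk := ker_inv k kx k1.
have kd : k ^ d = k.
  apply: (mulgI k); rewrite kk; apply: ker_inv; last by rewrite conjg_eq1.
  by rewrite -dx conj_ker.
have kdC : commute k d by rewrite /commute conjgC kd.
have : c ^+ 3 = k ^+ 3 by rewrite cE expgMn // d3 mulg1.
by rewrite c3 !expgS expg0 mulg1 kk mulg1 => E; rewrite cE -E mul1g.
Qed.

Lemma rotation3V x c : rotation3 x c -> rotation3 x c^-1.
Proof.
case=> cA cx cm c3; split.
- by rewrite groupV.
- by rewrite -{1}cx permK.
- by move=> y xy; apply: contra (cm _ xy) => /eqP E; rewrite -{1}E permKV.
by rewrite expgVn c3 invg1.
Qed.

Lemma rotation3_uniq x c d : rotation3 x c -> rotation3 x d -> c = d \/ c = d^-1.
Proof.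
move=> cr dr; have : [set y | e x y] != set0 by rewrite -card_gt0 e_cubic.
case/set0Pn=> y; rewrite inE => xy.
have [xcy ccy _] := rotation3_cycle cr xy; have [xdy ddy H] := rotation3_cycle dr xy.
case/or3P: (H _ xcy) => /eqP E.
- by case: cr => _ _ /(_ _ xy); rewrite E eqxx.
- by left; apply: (rotation3_agree cr dr xy).
right; apply: (rotation3_agree cr (rotation3V dr) xy); rewrite E.
by apply: (@perm_inj _ d); rewrite permKV; case: dr => _ _ _ d3; rewrite perm_cube1.
Qed.

Lemma rotation3_conj x f c d : f \in A -> rotation3 x c -> rotation3 (f x) d ->
  c ^ f = d \/ c ^ f = d^-1.
Proof.
move=> fA [cA cx cm c3] dr; apply: rotation3_uniq dr; split.
- by rewrite groupJ.
- by rewrite permJ cx.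
- by move=> y; rewrite -{1 2 3}(permKV f y) graph_autE // permJ (inj_eq perm_inj); exact: cm.
by rewrite -conjXg c3 conj1g.
Qed.

End CubicGraph.

(** * Points determined by straight arcs *)

Section PointExtension.
Variables (T P : finType) (e : rel T) (inc : P -> T -> Prop).
Hypothesis two_lines : forall p b c, inc p b -> e b c ->
  exists b', [/\ b' != b, e b' c, inc p b'
    & forall b'', e b'' c -> inc p b'' -> b'' = b \/ b'' = b'].
Hypothesis meet : forall c b1 b2, e b1 c -> e b2 c -> b1 != b2 ->
  exists p, [/\ inc p b1, inc p b2 & forall p', inc p' b1 -> inc p' b2 -> p' = p].
Hypothesis residue_ind : forall (Q : T -> Prop) p,
  (forall b b' c, inc p b -> inc p b' -> e b c -> e b' c -> Q b -> Q b') ->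
  forall b b', inc p b -> inc p b' -> Q b -> Q b'.
Hypothesis has_nb : forall b, exists c, e b c.

Definition straight (b1 b2 b3 : T) : Prop := exists p, [/\ inc p b1, inc p b2 & inc p b3].

Definition keeps_straight (f : {perm T}) := forall b1 c b2 c' b3,
  e b1 c -> e b2 c -> e b2 c' -> e b3 c' -> b1 != b2 -> b3 != b2 -> c != c' ->
  straight b1 b2 b3 -> straight (f b1) (f b2) (f b3).

(** Read [b] as lines and [c] as planes. The image of [p] is where the images of two of its lines in
    one plane meet. Straight arcs carry this from plane to plane on a line, and [residue_ind] from
    line to line around [p]. *)
Lemma point_image f p b0 : graph_aut e f -> keeps_straight f -> inc p b0 ->
  exists p', forall b, inc p b -> inc p' (f b).
Proof.
move=> fA fs pb0; have [c0 bc0] := has_nb b0.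
have [b1 [b10 bc1 pb1 H1]] := two_lines pb0 bc0.
have [|||p' [p'b1 p'b0 p'U]] := @meet (f c0) (f b1) (f b0); rewrite ?fA // ?(inj_eq perm_inj) //.
pose Q b := forall c b', e b c -> e b' c -> inc p b' -> inc p' (f b').
have Q0 : Q b0.
  move=> c b' bc bc' pb'.
  have [->//|b'0] := eqVneq b' b0.
  have [E|cc0] := eqVneq c0 c.
    by rewrite -E in bc'; case: (H1 _ bc' pb') => ->.
  have [|p'' [p1 p2 p3]] := fs _ _ _ _ _ bc1 bc0 bc bc' b10 b'0 cc0; first by exists p.
  by rewrite -(p'U p'').
have Qstep b b' c : inc p b -> inc p b' -> e b c -> e b' c -> Q b -> Q b'.
  move=> pb pb' bc b'c Qb c2 b2 b'c2 b2c2 pb2.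
  have [E|bb'] := eqVneq b b'; first by subst b'; exact: (Qb c2).
  have [->|b2b'] := eqVneq b2 b'; first exact: (Qb c).
  have [E|cc2] := eqVneq c c2.
    subst c2; exact: (Qb c).
  have [|p'' [q1 q2 q3]] := fs _ _ _ _ _ bc b'c b'c2 b2c2 bb' b2b' cc2; first by exists p.
  have [|||r [r1 r2 rU]] := @meet (f c) (f b) (f b'); rewrite ?fA // ?(inj_eq perm_inj) //.
  have -> : p' = p''; last by [].
  by rewrite (rU p'') // -(rU p') //; [apply: (Qb c) | apply: (Qb c)].
exists p' => b pb; have [c bc] := has_nb b.
by have Qb := residue_ind Qstep pb0 pb Q0; exact: (Qb c).
Qed.

Lemma point_image_uniq f p b0 p1 p2 : graph_aut e f -> inc p b0 ->
  (forall b, inc p b -> inc p1 (f b)) -> (forall b, inc p b -> inc p2 (f b)) -> p1 = p2.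
Proof.
move=> fA pb0 H1 H2; have [c0 bc0] := has_nb b0.
have [b1 [b10 bc1 pb1 _]] := two_lines pb0 bc0.
have [|||p' [_ _ U]] := @meet (f c0) (f b1) (f b0); rewrite ?fA // ?(inj_eq perm_inj) //.
by rewrite (U _ (H1 _ pb1) (H1 _ pb0)) (U _ (H2 _ pb1) (H2 _ pb0)).
Qed.

End PointExtension.

(** * Flags of a 4-polytope *)

Local Open Scope order_scope.

Section Polytope.
Context {d : Order.disp_t} {P : finPOrderType d}.
Variable rk : P -> int.
Hypothesis HP : is_4polytope rk.
Variables bot top : P.
Hypothesis bot_rk : rk bot = (-1)%R.
Hypothesis bot_le : forall y, bot <= y.
Hypothesis top_rk : rk top = 4%R.
Hypothesis le_top : forall y, y <= top.

Lemma rk_lt x y : x < y -> (rk x < rk y)%R.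
Proof. exact: (rank_strict_mono HP). Qed.

Lemma rk_range x : (-1 <= rk x <= 4)%R.
Proof. exact: (rank_range HP). Qed.

Lemma rk_comparable_eq x y : x >=< y -> rk x = rk y -> x = y.
Proof.
by case: comparableP => // [/rk_lt|/rk_lt] H _ E; move: H; rewrite E ltxx.
Qed.

Lemma rk_comparable_lt x y : x >=< y -> (rk x < rk y)%R -> x < y.
Proof.
by case: comparableP => // [/rk_lt H|->] _; [rewrite ltNge (ltW H) | rewrite ltxx].
Qed.

Lemma rk_bot x : rk x = (-1)%R -> x = bot.
Proof.
by move=> H; apply: rk_comparable_eq; rewrite ?bot_rk // /Order.comparable bot_le orbT.
Qed.

Lemma rk_top x : rk x = 4%R -> x = top.
Proof.
by move=> H; apply: rk_comparable_eq; rewrite ?top_rk // /Order.comparable le_top.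
Qed.

Lemma chainP (B : {set P}) : reflect {in B &, forall x y, x >=< y} (is_chain B).
Proof.
apply: (iffP forall_inP) => [H x y xB yB|H x xB]; first by have /forall_inP := H x xB; apply.
by apply/forall_inP=> y; exact: H.
Qed.

Lemma flag_ofP (S A : {set P}) :
  reflect [/\ is_chain A, A \subset S & forall C : {set P}, is_chain C -> C \subset S ->
    A \subset C -> C = A]
          (is_flag_of S A).
Proof.
apply: (iffP maxsetP) => [[/andP[cA AS] mA]|[cA AS mA]].
  by split=> // C cC CS; apply: mA; rewrite inE cC.
by split=> [|C /andP[]]; [rewrite inE cA | exact: mA].
Qed.

Lemma chain_in_flag (B : {set P}) : is_chain B -> exists2 A, is_flag A & B \subset A.
Proof.
move=> cB; have : [pred B : {set P} | is_chain B && (B \subset setT)] B by rewrite inE cB subsetT.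
by case/maxset_exists=> A; exists A.
Qed.

Lemma chain_bot_top (C : {set P}) : is_chain C -> is_chain (bot |: (top |: C)).
Proof.
move/chainP=> cC; apply/chainP=> x y; rewrite !inE.
have xb u : u >=< bot by rewrite /Order.comparable bot_le orbT.
have xt u : u >=< top by rewrite /Order.comparable le_top.
case/or3P=> [/eqP->|/eqP->|xC]; first by rewrite comparable_sym.
  by rewrite comparable_sym.
by case/or3P=> [/eqP->|/eqP->|yC] //; exact: cC.
Qed.

(** The six faces of a flag have distinct ranks, and only six values are possible. *)
Lemma flag_rank A j : is_flag A -> (-1 <= j <= 4)%R -> exists2 x, x \in A & rk x = j.
Proof.
move=> fA jr; have [/chainP cA _ _] := flag_ofP _ _ fA.
pose s := [seq rk x | x <- enum A].
pose t : seq int := [:: (-1)%R; 0%R; 1%R; 2%R; 3%R; 4%R].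
have us : uniq s.
  rewrite map_inj_in_uniq ?enum_uniq // => x y; rewrite !mem_enum => xA yA.
  by apply: rk_comparable_eq; exact: cA.
have st : {subset s <= t}.
  by move=> _ /mapP[x _ ->]; have := rk_range x; rewrite /t !inE; lia.
have [|_ E] := uniq_min_size us st.
  by rewrite size_map -cardE (flag_card HP fA).
have : j \in s by rewrite E /t !inE; lia.
by case/mapP=> x; rewrite mem_enum => xA ->; exists x.
Qed.

Lemma chain2 (x y : P) : x <= y -> is_chain [set x; y].
Proof.
move=> xy; apply/chainP=> u v; rewrite !inE => /orP[]/eqP-> /orP[]/eqP->;
by rewrite /Order.comparable ?lexx ?xy ?orbT.
Qed.

Lemma rk_between x y j : x < y -> (rk x < j < rk y)%R -> exists2 z, x < z < y & rk z = j.
Proof.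
move=> xy jr; have [A fA sA] := chain_in_flag (chain2 (ltW xy)).
have [|z zA zj] := @flag_rank A j fA.
  by have := rk_range x; have := rk_range y; lia.
have [/chainP cA _ _] := flag_ofP _ _ fA.
have xA : x \in A by rewrite (subsetP sA) // !inE eqxx.
have yA : y \in A by rewrite (subsetP sA) // !inE eqxx orbT.
case/andP: jr => j1 j2.
by exists z => //; rewrite !rk_comparable_lt ?zj //; exact: cA.
Qed.

(* Faces of ranks 0, 1, 2, 3; [r0], ..., [r3] below pass to the adjacent flags. *)
Definition quad := prod (prod (prod P P) P) P.

Definition quad_flag (q : quad) : bool := let: (a, b, c, z) := q in
  [&& rk a == 0%R, rk b == 1%R, rk c == 2%R & rk z == 3%R] && [&& a < b, b < c & c < z].

Definition quad_set (q : quad) : {set P} := let: (a, b, c, z) := q in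
  [set bot; a; b; c; z; top].

Lemma quad_set_flag q : quad_flag q -> is_flag (quad_set q).
Proof.
case: q => [[[a b] c] z] /andP[/and4P[/eqP ra /eqP rb /eqP rc /eqP rz] /and3P[ab bc cz]].
have ac := lt_trans ab bc; have bz := lt_trans bc cz; have az := lt_trans ab bz.
apply/flag_ofP; split; last 1 first.
- move=> C /chainP cC _ sC; apply/eqP; rewrite eqEsubset sC andbT.
  apply/subsetP=> x xC; have k y : y \in quad_set (a, b, c, z) -> rk x = rk y -> x = y.
    by move=> yq; apply: rk_comparable_eq; apply: cC => //; rewrite (subsetP sC).
  have : rk x = (-1)%R \/ rk x = 0%R \/ rk x = 1%R \/ rk x = 2%R \/ rk x = 3%R \/ rk x = 4%R.
    by have := rk_range x; lia.
  by case=> [|[|[|[|[|]]]]] E;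
    [rewrite (k bot) | rewrite (k a) | rewrite (k b)
    | rewrite (k c) | rewrite (k z) | rewrite (k top)];
    rewrite ?E // !inE eqxx ?orbT.
- apply/chainP=> x y; rewrite !inE -!orbA.
  by do ![case/or4P || case/orP] => /eqP-> ; do ![case/or4P || case/orP] => /eqP->;
    rewrite /Order.comparable ?lexx ?bot_le ?le_top ?(ltW ab) ?(ltW bc) ?(ltW cz) ?(ltW ac)
      ?(ltW bz) ?(ltW az) ?orbT.
exact: subsetT.
Qed.

Lemma flag_quad A : is_flag A -> exists2 q, quad_flag q & A = quad_set q.
Proof.
move=> fA; have [/chainP cA _ _] := flag_ofP _ _ fA.
have [//|u uA ru] := @flag_rank A (-1)%R fA; have {ru} := rk_bot ru => ub.
have [//|t tA rt] := @flag_rank A 4%R fA; have {rt} := rk_top rt => tt.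
have [//|a aA ra] := @flag_rank A 0%R fA; have [//|b bA rb] := @flag_rank A 1%R fA.
have [//|c cA' rc] := @flag_rank A 2%R fA; have [//|z zA rz] := @flag_rank A 3%R fA.
have qf : quad_flag (a, b, c, z).
  by rewrite /= ra rb rc rz !eqxx !rk_comparable_lt ?ra ?rb ?rc ?rz //; exact: cA.
exists (a, b, c, z) => //.
have [_ _ mA] := flag_ofP _ _ (quad_set_flag qf).
apply: mA; [exact/chainP | exact: subsetT |].
by rewrite ub in uA; rewrite tt in tA; rewrite !subUset !sub1set uA aA bA cA' zA tA.
Qed.

Definition quad_within (F G : P) (q : quad) : bool := let: (a, b, c, z) := q in
  [&& quad_flag q, F <= a & z <= G].

(** * Induction along the flags of a section *)

Section SectionInduction.
Variables (F G : P) (Q : quad -> Prop).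
Hypothesis F_rk : (rk F <= 0)%R.
Hypothesis G_rk : (3 <= rk G)%R.
Hypothesis FG : F <= G.
Hypothesis Q0 : forall a a' b c z, quad_within F G (a, b, c, z) ->
  quad_within F G (a', b, c, z) -> Q (a, b, c, z) -> Q (a', b, c, z).
Hypothesis Q1 : forall a b b' c z, quad_within F G (a, b, c, z) ->
  quad_within F G (a, b', c, z) -> Q (a, b, c, z) -> Q (a, b', c, z).
Hypothesis Q2 : forall a b c c' z, quad_within F G (a, b, c, z) ->
  quad_within F G (a, b, c', z) -> Q (a, b, c, z) -> Q (a, b, c', z).
Hypothesis Q3 : forall a b c z z', quad_within F G (a, b, c, z) ->
  quad_within F G (a, b, c, z') -> Q (a, b, c, z) -> Q (a, b, c, z').

Let S := section F G.

(** A chain containing the trace of [q] in the section, enlarged by [bot] and [top], contains all of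
    [quad_set q], so the maximality of that flag applies. *)
Lemma within_flag q : quad_within F G q -> is_flag_of S (quad_set q :&: S).
Proof.
move=> qw; have qf : quad_flag q by case: q qw => [[[a b] c] z] /and3P[].
have [/chainP cq _ mq] := flag_ofP _ _ (quad_set_flag qf).
apply/flag_ofP; split; last 1 first.
- move=> C /chainP cC CS sC.
  have sq : quad_set q \subset bot |: (top |: C).
    apply/subsetP=> x xq; rewrite !inE; have [//|xb] := eqVneq x bot.
    have [//|xt /=] := eqVneq x top; apply: (subsetP sC); rewrite inE xq /=.
    case: q qw xq {qf cq mq sC} => [[[a b] c] z] /= /and3P[/andP[_ /and3P[ab bc cz]] Fa zG].
    rewrite !inE (negPf xb) (negPf xt) orbF /= -!orbA.
    by case/or4P=> /eqP->; rewrite ?Fa ?zG /= ?(le_trans Fa) ?(le_trans _ zG) ?ltW //;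
      do ?[exact: (lt_trans ab) | exact: (lt_trans bc) | apply: (lt_trans ab);
        exact: (lt_trans bc)].
  have E : bot |: (top |: C) = quad_set q.
    apply: mq => //; rewrite ?subsetT //.
    exact/chain_bot_top/chainP.
  apply/eqP; rewrite eqEsubset sC andbT subsetI CS andbT -E.
  by apply/subsetP=> x xC; rewrite !inE xC !orbT.
- by apply/chainP=> x y /setIP[xq _] /setIP[yq _]; exact: cq.
exact: subsetIr.
Qed.

(** [X] with [bot] and [top] extends to a flag of the whole poset. By maximality [F] and [G] lie in
    [X], so comparing ranks in this flag gives [F <= a] and [z <= G]. *)
Lemma flag_within X : is_flag_of S X -> exists2 q, quad_within F G q & X = quad_set q :&: S.
Proof.
case/flag_ofP=> /chainP cX XS mX.
have [|A fA sA] := @chain_in_flag (bot |: (top |: X)).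
  exact/chain_bot_top/chainP.
have [q qf AE] := flag_quad fA; have [/chainP cA _ _] := flag_ofP _ _ fA.
have XA : X \subset A by apply: subset_trans sA; apply/subsetP=> x xX; rewrite !inE xX !orbT.
have E : X = quad_set q :&: S.
  apply/esym; apply: mX; last by rewrite subsetI XS -AE XA.
    by apply/chainP=> x y /setIP[xq _] /setIP[yq _]; apply: cA; rewrite AE.
  exact: subsetIr.
have inX Z : Z \in S -> (forall x, x \in X -> x >=< Z) -> Z \in X.
  move=> ZS ZC; have <- : Z |: X = X; last by rewrite !inE eqxx.
  apply: mX; [|by rewrite subUset sub1set ZS|exact: subsetUr].
  apply/chainP=> x y; rewrite !inE => /orP[/eqP->|xX] /orP[/eqP->|yX];
    rewrite ?comparablexx //; [rewrite comparable_sym; exact: ZC|exact: ZC|exact: cX].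
have FX : F \in X.
  apply: inX; first by rewrite inE lexx.
  by move=> x /(subsetP XS); rewrite inE => /andP[Fx _]; rewrite /Order.comparable Fx orbT.
have GX : G \in X.
  apply: inX; first by rewrite inE lexx andbT.
  by move=> x /(subsetP XS); rewrite inE => /andP[_ xG]; rewrite /Order.comparable xG.
exists q => //; have FA := subsetP XA _ FX; have GA := subsetP XA _ GX.
case: q qf AE {E} => [[[a b] c] z] qf AE.
have aA : a \in A by rewrite AE !inE eqxx ?orbT.
have zA : z \in A by rewrite AE !inE eqxx ?orbT.
rewrite /quad_within qf /=; case/andP: qf => /and4P[/eqP ra _ _ /eqP rz] _.
apply/andP; split.
  by have := cA _ _ FA aA; case: comparableP => // /rk_lt; rewrite ra ltNge F_rk.
by have := cA _ _ GA zA; case: comparableP => // /rk_lt; rewrite rz ltNge G_rk.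
Qed.

(** In each rank the entries of [q] and [q'] agree unless that of [q] is [u], and [u] occurs in one
    rank only. So at most one entry changes. *)
Lemma within_adjacent q q' u : quad_within F G q -> quad_within F G q' ->
  (quad_set q :&: S) :\: (quad_set q' :&: S) \subset [set u] -> Q q -> Q q'.
Proof.
case: q q' => [[[a b] c] z] [[[a' b'] c'] z'] qw qw' /subsetP uE Qq.
have key x y r : x \in quad_set (a, b, c, z) -> F <= x <= G -> y \in quad_set (a', b', c', z') ->
   rk x = r -> rk y = r -> x = y \/ x = u.
  move=> xq xS yq xr yr; case: (boolP (x \in quad_set (a', b', c', z'))) => xq'.
    left; apply: rk_comparable_eq; last by rewrite xr yr.
    have qf' : quad_flag (a', b', c', z') by case/and3P: qw'.
    by have [/chainP cq _ _] := flag_ofP _ _ (quad_set_flag qf'); exact: cq.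
  right; apply/set1P/uE; rewrite in_setD in_setI (negPf xq') /= in_setI xq /=.
  by rewrite inE.
have /and3P[/andP[/and4P[/eqP ra /eqP rb /eqP rc /eqP rz] /and3P[ab bc cz]] Fa zG] := qw.
have /and3P[/andP[/and4P[/eqP ra' /eqP rb' /eqP rc' /eqP rz'] _] _ _] := qw'.
have Fb := le_trans Fa (ltW ab); have Fc := le_trans Fb (ltW bc); have Fz := le_trans Fc (ltW cz).
have cG := le_trans (ltW cz) zG; have bG := le_trans (ltW bc) cG; have aG := le_trans (ltW ab) bG.
have Ka : a = a' \/ a = u by apply: (key _ _ 0%R); rewrite ?Fa ?aG // !inE eqxx ?orbT.
have Kb : b = b' \/ b = u by apply: (key _ _ 1%R); rewrite ?Fb ?bG // !inE eqxx ?orbT.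
have Kc : c = c' \/ c = u by apply: (key _ _ 2%R); rewrite ?Fc ?cG // !inE eqxx ?orbT.
have Kz : z = z' \/ z = u by apply: (key _ _ 3%R); rewrite ?Fz ?zG // !inE eqxx ?orbT.
have ac := lt_trans ab bc; have bz := lt_trans bc cz; have az := lt_trans ab bz.
case: Ka Kb Kc Kz => [Ea|Ea] [Eb|Eb] [Ec|Ec] [Ez|Ez]; try subst a'; try subst b';
  try subst c'; try subst z'.
all: try (by exfalso; subst; move: ab bc cz ac bz az; rewrite ltxx).
- by [].
- by apply: (Q3 qw).
- by apply: (Q2 qw).
- by apply: (Q1 qw).
by apply: (Q0 qw).
Qed.

Lemma section_ind q q' : quad_within F G q -> quad_within F G q' -> Q q -> Q q'.
Proof.
move=> qw qw' Qq.
have /connectP[p] := strongly_flag_connected HP FG (within_flag qw) (within_flag qw').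
(* An empty path means equal traces; their empty difference lies in any singleton, here that of
   [bot]. *)
elim: p q qw Qq => [|X p IH] q qw Qq /=; first by move=> _ E;
  apply: (@within_adjacent q q' bot) => //; rewrite -E setDv sub0set.
case/andP=> /and3P[_ fX adj] pp lp.
have [q1 q1w XE] := flag_within fX; rewrite XE in adj pp lp.
apply: (IH q1) => //; case/andP: adj => /cards1P[u uE] _.
by apply: (within_adjacent qw q1w _ Qq); rewrite uE.
Qed.

End SectionInduction.

(** * Automorphisms and adjacent flags *)

Lemma aut_lt g (x y : P) : poset_aut g -> (g x < g y) = (x < y).
Proof. by move=> gA; rewrite !lt_neqAle gA (inj_eq perm_inj). Qed.

Lemma poset_autM g h : @poset_aut _ P g -> poset_aut h -> poset_aut (g * h)%g.
Proof. by move=> gA hA x y; rewrite !permM hA gA. Qed.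

Lemma poset_autV g : @poset_aut _ P g -> poset_aut g^-1%g.
Proof. by move=> gA x y; rewrite -{2}(permKV g x) -{2}(permKV g y) gA. Qed.

Lemma poset_aut1 : @poset_aut _ P 1%g.
Proof. by move=> x y; rewrite !perm1. Qed.

Lemma bot_lt x : (-1 < rk x)%R -> bot < x.
Proof. by rewrite [bot < x]lt_neqAle bot_le andbT; apply: contraTneq => <-; rewrite bot_rk. Qed.

Lemma lt_top x : (rk x < 4)%R -> x < top.
Proof. by rewrite [x < _]lt_neqAle le_top andbT; apply: contraTneq => ->; rewrite top_rk. Qed.

Lemma cover_up (x y : P) : x < y -> exists2 z, x < z <= y & rk z = (rk x + 1)%R.
Proof.
move=> xy; have := rk_lt xy; have [E|ne lt] := eqVneq (rk y) (rk x + 1)%R.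
  by exists y; rewrite ?xy ?lexx.
have [|z /andP[xz zy] rz] := rk_between (j := (rk x + 1)%R) xy; first by move/eqP: ne; lia.
by exists z; rewrite ?xz ?ltW.
Qed.

Lemma cover_down (x y : P) : x < y -> exists2 z, x <= z < y & rk z = (rk y - 1)%R.
Proof.
move=> xy; have := rk_lt xy; have [E|ne lt] := eqVneq (rk x) (rk y - 1)%R.
  by exists x; rewrite ?xy ?lexx.
have [|z /andP[xz zy] rz] := rk_between (j := (rk y - 1)%R) xy; first by move/eqP: ne; lia.
by exists z; rewrite ?zy ?ltW.
Qed.

(** Going down one rank at a time shows that an automorphism lowers no rank, and neither does its
    inverse. *)
Lemma aut_rk g x : poset_aut g -> rk (g x) = rk x.
Proof.
move=> gA; have main h y : poset_aut h -> (rk y <= rk (h y))%R.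
  move=> hA; have [n] : exists n : nat, (rk y <= n%:Z - 1)%R.
    by exists (absz (rk y + 1)%R); have := rk_range y; lia.
  elim: n y => [|n IH] y ry; first by have := rk_range (h y); lia.
  case: (boolP (-1 < rk y)%R) => [ry'|]; last by have := rk_range (h y); lia.
  have [z /andP[_ zy] rz] := cover_down (bot_lt ry').
  have rz' : (rk z <= n%:Z - 1)%R by lia.
  have := IH _ rz'; have : h z < h y by rewrite aut_lt.
  by move/rk_lt; lia.
have := main _ x gA; have := main _ (g x) (poset_autV gA); rewrite permK; lia.
Qed.

(** The default [x] occurs only outside the diamond situation of [otherP]. *)
Definition other F x G := odflt x [pick y | [&& rk y == rk x, F < y < G & y != x]].

Lemma otherP F x G : F < x < G -> rk F = (rk x - 1)%R -> rk G = (rk x + 1)%R ->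
  [/\ rk (other F x G) = rk x, F < other F x G < G, other F x G != x
    & forall y, rk y = rk x -> F < y < G -> y != x -> y = other F x G].
Proof.
move=> FxG rF rG; have FG : F < G by case/andP: FxG; exact: lt_trans.
have := diamond HP FG rF rG; rewrite (cardsD1 x) inE eqxx FxG /= add1n => -[] /eqP/cards1P[u uE].
have uP y : (y == u) = [&& rk y == rk x, F < y < G & y != x].
  by rewrite -in_set1 -uE !inE [RHS]andbA andbC.
rewrite /other; case: pickP => [y|/(_ u)]; last by rewrite -uP eqxx.
rewrite -uP => /eqP->; have := uP u; rewrite eqxx => /esym/and3P[/eqP ru Fu ux].
by split=> // y' ry Fy yx; apply/eqP; rewrite uP ry eqxx Fy.
Qed.

Lemma aut_other g F x G : poset_aut g -> F < x < G -> rk F = (rk x - 1)%R ->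
  rk G = (rk x + 1)%R -> other (g F) (g x) (g G) = g (other F x G).
Proof.
move=> gA FxG rF rG; have [r1 r2 r3 _] := otherP FxG rF rG.
have [|||_ _ _ U] := @otherP (g F) (g x) (g G); rewrite ?aut_lt ?aut_rk //.
by apply/esym/U; rewrite ?aut_lt ?aut_rk ?(inj_eq perm_inj).
Qed.

Lemma other_other F x G : F < x < G -> rk F = (rk x - 1)%R -> rk G = (rk x + 1)%R ->
  other F (other F x G) G = x.
Proof.
move=> FxG rF rG; have [r1 r2 r3 _] := otherP FxG rF rG.
have [|||_ _ _ U] := @otherP F (other F x G) G; rewrite ?r1 //.
by apply/esym/U; rewrite // eq_sym.
Qed.

Definition r0 (q : quad) : quad := let: (a, b, c, z) := q in (other bot a b, b, c, z).
Definition r1 (q : quad) : quad := let: (a, b, c, z) := q in (a, other a b c, c, z).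
Definition r2 (q : quad) : quad := let: (a, b, c, z) := q in (a, b, other b c z, z).
Definition r3 (q : quad) : quad := let: (a, b, c, z) := q in (a, b, c, other c z top).
Definition quad_map (g : {perm P}) (q : quad) : quad :=
  let: (a, b, c, z) := q in (g a, g b, g c, g z).

Lemma quad_flagP (a b c z : P) : reflect
  [/\ [/\ rk a = 0, rk b = 1, rk c = 2 & rk z = 3]%R, a < b, b < c & c < z]
  (quad_flag (a, b, c, z)).
Proof.
apply: (iffP andP) => [[/and4P[/eqP-> /eqP-> /eqP-> /eqP->] /and3P[]]|[[-> -> -> ->] -> -> ->]] //.
Qed.

Lemma quad_others (a b c z : P) : quad_flag (a, b, c, z) ->
  [/\ [/\ rk (other bot a b) = 0%R, other bot a b < b & other bot a b != a],
      [/\ rk (other a b c) = 1%R, a < other a b c < c & other a b c != b],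
      [/\ rk (other b c z) = 2%R, b < other b c z < z & other b c z != c]
    & [/\ rk (other c z top) = 3%R, c < other c z top & other c z top != z]]
  /\ [/\ other bot (other bot a b) b = a, other a (other a b c) c = b,
      other b (other b c z) z = c & other c (other c z top) top = z].
Proof.
case/quad_flagP=> [[ra rb rc rz] ab bc cz].
have ba : bot < a < b by rewrite bot_lt ?ra.
have abc : a < b < c by rewrite ab.
have bcz : b < c < z by rewrite bc.
have czt : c < z < top by rewrite cz lt_top ?rz.
have [||a1 /andP[_ a2] a3 _] := otherP ba; rewrite ?bot_rk ?ra ?rb //.
have [||b1 b2 b3 _] := otherP abc; rewrite ?ra ?rb ?rc //.
have [||c1 c2 c3 _] := otherP bcz; rewrite ?rz ?rb ?rc //.
have [||z1 /andP[z2 _] z3 _] := otherP czt; rewrite ?rz ?top_rk ?rc //.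
by rewrite !other_other ?a1 ?b1 ?c1 ?z1 ?ra ?rb ?rc ?rz ?bot_rk ?top_rk.
Qed.

Lemma r0_flag q : quad_flag q -> quad_flag (r0 q).
Proof.
case: q => [[[a b] c] z] qf; have [[[A1 A2 _] _ _ _] _] := quad_others qf.
by case/quad_flagP: qf => [[ra rb rc rz] ab bc cz]; apply/quad_flagP.
Qed.
Lemma r1_flag q : quad_flag q -> quad_flag (r1 q).
Proof.
case: q => [[[a b] c] z] qf; have [[_ [A1 /andP[A2 A3] _] _ _] _] := quad_others qf.
by case/quad_flagP: qf => [[ra rb rc rz] ab bc cz]; apply/quad_flagP.
Qed.
Lemma r2_flag q : quad_flag q -> quad_flag (r2 q).
Proof.
case: q => [[[a b] c] z] qf; have [[_ _ [A1 /andP[A2 A3] _] _] _] := quad_others qf.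
by case/quad_flagP: qf => [[ra rb rc rz] ab bc cz]; apply/quad_flagP.
Qed.
Lemma r3_flag q : quad_flag q -> quad_flag (r3 q).
Proof.
case: q => [[[a b] c] z] qf; have [[_ _ _ [A1 A2 _]] _] := quad_others qf.
by case/quad_flagP: qf => [[ra rb rc rz] ab bc cz]; apply/quad_flagP.
Qed.
Lemma r0K q : quad_flag q -> r0 (r0 q) = q.
Proof. by case: q => [[[a b] c] z] /quad_others[_ [/= -> _ _ _]]. Qed.
Lemma r1K q : quad_flag q -> r1 (r1 q) = q.
Proof. by case: q => [[[a b] c] z] /quad_others[_ [/= _ -> _ _]]. Qed.
Lemma r2K q : quad_flag q -> r2 (r2 q) = q.
Proof. by case: q => [[[a b] c] z] /quad_others[_ [/= _ _ -> _]]. Qed.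
Lemma r3K q : quad_flag q -> r3 (r3 q) = q.
Proof. by case: q => [[[a b] c] z] /quad_others[_ [/= _ _ _ ->]]. Qed.

Lemma aut_bot g : poset_aut g -> g bot = bot.
Proof. by move=> gA; apply: rk_bot; rewrite aut_rk. Qed.
Lemma aut_top g : poset_aut g -> g top = top.
Proof. by move=> gA; apply: rk_top; rewrite aut_rk. Qed.

Lemma quad_map_r g q : poset_aut g -> quad_flag q ->
  [/\ r0 (quad_map g q) = quad_map g (r0 q), r1 (quad_map g q) = quad_map g (r1 q),
      r2 (quad_map g q) = quad_map g (r2 q) & r3 (quad_map g q) = quad_map g (r3 q)].
Proof.
move=> gA; case: q => [[[a b] c] z] /quad_flagP[[ra rb rc rz] ab bc cz] /=.
by split; rewrite -1?{1}(aut_bot gA) -1?{1}(aut_top gA) aut_other //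
  ?ab ?bc ?cz ?bot_lt ?lt_top ?ra ?rb ?rc ?rz ?bot_rk ?top_rk.
Qed.

Lemma quad_mapM g h q : quad_map (g * h)%g q = quad_map h (quad_map g q).
Proof. by case: q => [[[a b] c] z]; rewrite /= !permM. Qed.

Lemma flag_ind (Q : quad -> Prop) :
  (forall q, quad_flag q -> Q q -> [/\ Q (r0 q), Q (r1 q), Q (r2 q) & Q (r3 q)]) ->
  forall q q', quad_flag q -> quad_flag q' -> Q q -> Q q'.
Proof.
move=> QS q q' qf qf'.
have w q1 : quad_flag q1 -> quad_within bot top q1.
  by case: q1 => [[[a b] c] z] qf1; rewrite /quad_within qf1 bot_le le_top.
apply: (@section_ind bot top Q) (w _ qf) (w _ qf') => //; rewrite ?bot_rk ?top_rk //.
- move=> a a' b c z /and3P[qa _ _] /and3P[qa' _ _] Qa.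
  have [->//|ne] := eqVneq a' a; have [/= QQ _ _ _] := QS _ qa Qa.
  case/quad_flagP: qa qa' => [[ra rb rc rz] ab bc cz] /quad_flagP[[ra' _ _ _] ab' _ _].
  have [|||_ _ _ U] := @otherP bot a b; rewrite ?ab ?bot_lt ?bot_rk ?ra ?rb //.
  by rewrite (U a') // ?ra' // ?ab' ?bot_lt ?ra'.
- move=> a b b' c z /and3P[qa _ _] /and3P[qa' _ _] Qa.
  have [->//|ne] := eqVneq b' b; have [/= _ QQ _ _] := QS _ qa Qa.
  case/quad_flagP: qa qa' => [[ra rb rc rz] ab bc cz] /quad_flagP[[_ rb' _ _] ab' bc' _].
  have [|||_ _ _ U] := @otherP a b c; rewrite ?ab ?bc ?ra ?rb ?rc //.
  by rewrite (U b') // ?rb' // ?ab' ?bc'.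
- move=> a b c c' z /and3P[qa _ _] /and3P[qa' _ _] Qa.
  have [->//|ne] := eqVneq c' c; have [/= _ _ QQ _] := QS _ qa Qa.
  case/quad_flagP: qa qa' => [[ra rb rc rz] ab bc cz] /quad_flagP[[_ _ rc' _] _ bc' cz'].
  have [|||_ _ _ U] := @otherP b c z; rewrite ?cz ?bc ?rb ?rc ?rz //.
  by rewrite (U c') // ?rc' // ?bc' ?cz'.
move=> a b c z z' /and3P[qa _ _] /and3P[qa' _ _] Qa.
have [->//|ne] := eqVneq z' z; have [/= _ _ _ QQ] := QS _ qa Qa.
case/quad_flagP: qa qa' => [[ra rb rc rz] ab bc cz] /quad_flagP[[_ _ _ rz'] _ _ cz'].
have [|||_ _ _ U] := @otherP c z top; rewrite ?cz ?lt_top ?rc ?rz ?top_rk //.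
by rewrite (U z') // ?rz' // ?cz' ?lt_top ?rz'.
Qed.

Lemma in_quad x : exists2 q, quad_flag q & x \in quad_set q.
Proof.
have [|A fA sA] := @chain_in_flag [set x].
  by apply/chainP=> u v; rewrite !inE => /eqP-> /eqP->; exact: comparablexx.
have [q qf AE] := flag_quad fA; exists q => //.
by rewrite -AE (subsetP sA) // inE.
Qed.

(** An automorphism commutes with [r0], ..., [r3], so by [flag_ind] it fixes all flags once it fixes
    one, and every face lies on a flag. *)
Lemma aut_rigid g q : poset_aut g -> quad_flag q -> quad_map g q = q -> g = 1%g.
Proof.
move=> gA qf gq; apply/permP=> x; rewrite perm1.
have [q' qf' xq'] := in_quad x.
have : quad_map g q' = q'.
  apply: (@flag_ind (fun q => quad_map g q = q) _ q) => // q1 qf1 E.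
  by have [E0 E1 E2 E3] := quad_map_r gA qf1; rewrite -E0 -E1 -E2 -E3 E.
case: q' {qf'} xq' => [[[a b] c] z] /= xq [ga gb gc gz].
move: xq; rewrite !inE -!orbA.
by case/orP=> [/eqP->|]; [rewrite aut_bot | case/orP=> [/eqP->//|]; case/or4P=> /eqP-> //;
  rewrite aut_top].
Qed.

(** * Rotations of polygonal sections *)

Lemma ordS_neq n (k : 'I_n) : (1 < n)%N -> ordS k != k.
Proof.
move=> n1; apply/eqP=> /(congr1 val) /=; have := ltn_ord k.
by rewrite leq_eqVlt => /predU1P[E|lt]; [rewrite E modnn; lia | rewrite modn_small //; lia].
Qed.

Lemma ordSS_neq n (k : 'I_n) : (2 < n)%N -> ordS (ordS k) != k.
Proof.
move=> n2; apply/eqP=> /(congr1 val) /=; have := ltn_ord k.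
rewrite -[X in (X %% n)%N]addn1 modnDml addn1 => lt.
have [lt'|le] := ltnP k.+2 n; first by rewrite modn_small //; lia.
have -> : k.+2 = (k.+2 - n + n)%N by lia.
rewrite modnDr modn_small; lia.
Qed.

(** The rotation is prescribed on edges only. For [n > 2] consecutive edges share a single vertex,
    so the vertices rotate in the same sense. *)
Lemma section_rotation n (F G x y : P) (v e : 'I_n -> P) (s : {perm P}) :
  (2 < n)%N -> polygon_labelling rk F G v e -> (forall k, s (e k) = e (ordS k)) ->
  poset_aut s -> s F = F -> s G = G ->
  F < x -> x < y -> y < G -> rk x = (rk F + 1)%R -> rk y = (rk F + 2)%R ->
  [/\ s x != x, s y != y & (x < s y) || (s x < y)].
Proof.
move=> n2 [vI eI vP eP inc] se sA sF sG Fx xy yG rx ry.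
have n1 : (1 < n)%N := ltnW n2.
have [i xE] : exists i, x = v i by apply/vP; rewrite Fx (lt_trans xy).
have [k yE] : exists k, y = e k by apply/eP; rewrite (lt_trans Fx) ?xy.
have sv j : s (v (ordS j)) = v (ordS (ordS j)).
  have [/andP[Fv vG] rv] : F < v (ordS j) < G /\ rk (v (ordS j)) = (rk F + 1)%R.
    by apply/vP; exists (ordS j).
  have [j' E] : exists j', s (v (ordS j)) = v j'.
    by apply/vP; rewrite aut_rk // rv -{1}sF -{1}sG !aut_lt // Fv vG.
  have H1 : v j' < e (ordS j) by rewrite -E -se aut_lt // inc eqxx orbT.
  have H2 : v j' < e (ordS (ordS j)) by rewrite -E -se aut_lt // inc eqxx.
  rewrite E; move: H1 H2; rewrite !inc => /orP[]/eqP-> // /orP[]/eqP E' //.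
    by case/eqP: (ordS_neq (ordS j) n1).
  by case/eqP: (ordSS_neq (ordS j) n2).
have sv' j : s (v j) = v (ordS j) by have := sv (ord_pred j); rewrite ord_predK.
rewrite xE yE se sv' !(inj_eq vI) !(inj_eq eI) !ordS_neq //; split=> //.
by move: xy; rewrite xE yE !inc => /orP[]/eqP->; rewrite eqxx ?orbT.
Qed.

Lemma polygon_card n m (F G : P) (v e : 'I_n -> P) : is_polygon rk m F G ->
  polygon_labelling rk F G v e -> n = m.
Proof.
move=> [v' [e' [_ e'I _ e'P _]]] [_ eI _ eP _].
have E : [set e k | k : 'I_n] = [set e' k | k : 'I_m].
  apply/setP=> x; apply/imsetP/imsetP => -[k _ xE].
    have [k' ->] : exists k, x = e' k by apply/e'P/eP; exists k.
    by exists k'.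
  have [k' ->] : exists k, x = e k by apply/eP/e'P; exists k.
  by exists k'.
by have := congr1 (fun A : {set P} => #|A|) E; rewrite !card_imset // !card_ord.
Qed.


(** * Orbits of flags *)

Definition rr i : quad -> quad :=
  match i with 0 => r0 | 1 => r1 | 2 => r2 | _ => r3 end.

Lemma rr_flag i q : quad_flag q -> quad_flag (rr i q).
Proof. by case: i => [|[|[|i]]]; [exact: r0_flag|exact: r1_flag|exact: r2_flag|exact: r3_flag]. Qed.

Lemma rrK i q : quad_flag q -> rr i (rr i q) = q.
Proof. by case: i => [|[|[|i]]]; [exact: r0K|exact: r1K|exact: r2K|exact: r3K]. Qed.

Lemma quad_map_rr i g q : poset_aut g -> quad_flag q -> rr i (quad_map g q) = quad_map g (rr i q).
Proof. by move=> gA qf; have [] := quad_map_r gA qf; case: i => [|[|[|i]]]. Qed.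

Definition linked (q q' : quad) := exists2 g, poset_aut g & quad_map g q = q'.

Lemma linked_refl q : linked q q.
Proof. by exists 1%g; [exact: poset_aut1 | case: q => [[[a b] c] z]; rewrite /= !perm1]. Qed.

Lemma linked_sym q q' : linked q q' -> linked q' q.
Proof.
case=> g gA <-; exists g^-1%g; first exact: poset_autV.
by rewrite -quad_mapM mulgV; case: q => [[[a b] c] z]; rewrite /= !perm1.
Qed.

Lemma linked_trans q1 q2 q3 : linked q1 q2 -> linked q2 q3 -> linked q1 q3.
Proof.
by case=> g gA <- [h hA <-]; exists (g * h)%g; [exact: poset_autM | rewrite quad_mapM].
Qed.

Lemma linked_rr i q q' : quad_flag q -> linked q q' -> linked (rr i q) (rr i q').
Proof. by move=> qf [g gA <-]; exists g => //; rewrite quad_map_rr. Qed.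

Definition even_linked q := forall i j, (i < 4)%N -> (j < 4)%N -> linked q (rr i (rr j q)).

Lemma even_linked_trans q q' : quad_flag q -> linked q q' -> even_linked q -> even_linked q'.
Proof.
move=> qf qq' eq i j i4 j4.
apply: linked_trans (linked_sym qq') (linked_trans (eq i j i4 j4) _).
by apply: linked_rr; [exact: rr_flag | exact: linked_rr].
Qed.

(** Links to [rr i (rr j q)] can be reversed and composed like the words themselves, so consecutive
    indices suffice. Either order is allowed because the sense of a rotation is not known. *)
Lemma even_linked_base q : quad_flag q ->
  (forall i, (i < 3)%N -> linked q (rr i (rr i.+1 q)) \/ linked q (rr i.+1 (rr i q))) ->
  even_linked q.
Proof.
move=> qf base.
have symE i j : linked q (rr i (rr j q)) -> linked q (rr j (rr i q)).
  move=> H; have := linked_rr j (rr_flag i qf) (linked_rr i qf H).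
  by rewrite rrK ?rr_flag // rrK // => /linked_sym.
have transE i j k : linked q (rr i (rr j q)) -> linked q (rr j (rr k q)) ->
  linked q (rr i (rr k q)).
  move=> H1 H2; apply: linked_trans H1 _.
  have := linked_rr i (rr_flag j qf) (linked_rr j qf H2).
  by rewrite (rrK j) // rr_flag.
have reflE i : linked q (rr i (rr i q)) by rewrite rrK //; exact: linked_refl.
have step i : (i < 3)%N -> linked q (rr i (rr i.+1 q)).
  by case/base=> // /symE.
have s0 := step 0 isT; have s1 := step 1 isT; have s2 := step 2 isT.
have s02 := transE _ _ _ s0 s1; have s13 := transE _ _ _ s1 s2; have s03 := transE _ _ _ s0 s13.
by case=> [|[|[|[|]]]] // -[|[|[|[|]]]] // _ _; auto.
Qed.

(** A parity argument: after each adjacency step the flag or its [r0]-neighbour is in the orbit of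
    [q]. *)
Lemma linked_orbits q q' : quad_flag q -> quad_flag q' -> even_linked q ->
  linked q q' \/ linked q (r0 q').
Proof.
move=> qf qf' eq.
apply: (@flag_ind (fun q' => linked q q' \/ linked q (r0 q')) _ q) => //; last by left;
  exact: linked_refl.
move=> q1 qf1 H.
have main i : (i < 4)%N -> linked q (rr i q1) \/ linked q (r0 (rr i q1)).
  move=> i4; case: H => H.
    by right; apply: (linked_trans H); exact: (even_linked_trans qf H eq (i := 0)).
  left; have := even_linked_trans qf H eq (i := i) (j := 0) i4 isT.
  by rewrite /= r0K // => H'; exact: linked_trans H H'.
by split; [exact: (main 0)|exact: (main 1)|exact: (main 2)|exact: (main 3)].
Qed.

(** The sense in which [s] turns decides which incidence of [section_rotation] holds; the diamond
    condition then determines [s x] and [s y]. *)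
Lemma section_rotation_other n (F G x y : P) (v e : 'I_n -> P) (s : {perm P}) :
  (2 < n)%N -> polygon_labelling rk F G v e -> (forall k, s (e k) = e (ordS k)) ->
  poset_aut s -> s F = F -> s G = G ->
  F < x -> x < y -> y < G -> rk x = (rk F + 1)%R -> rk y = (rk F + 2)%R -> rk G = (rk F + 3)%R ->
  (s x = other F x y /\ s y = other (s x) y G) \/
  (s y = other x y G /\ s x = other F x (s y)).
Proof.
move=> n2 lab se sA sF sG Fx xy yG rx ry rG.
have [nx ny] := section_rotation n2 lab se sA sF sG Fx xy yG rx ry.
have oth H u K w : H < u < K -> rk H = (rk u - 1)%R -> rk K = (rk u + 1)%R ->
  rk w = rk u -> H < w < K -> w != u -> w = other H u K.
  by move=> h1 h2 h3; have [_ _ _] := otherP h1 h2 h3; apply.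
have rsx := aut_rk x sA; have rsy := aut_rk y sA.
have Fsx : F < s x by rewrite -sF aut_lt.
have sxy : s x < s y by rewrite aut_lt.
have syG : s y < G by rewrite -sG aut_lt.
have [a1 a2 a3 a4] : [/\ rk F = rk x - 1, rk y = rk x + 1, rk G = rk y + 1 & rk x = rk y - 1]%R.
  by clear - rx ry rG; split; lia.
by case/orP=> H; [right|left]; split; apply: oth; rewrite ?Fx ?xy ?yG ?Fsx ?sxy ?syG ?H ?rsx ?rsy.
Qed.

Lemma rotation_linked (a b c z : P) (j : nat) s : quad_flag (a, b, c, z) -> (j < 3)%N ->
  is_rotation rk (quad_set (a, b, c, z)) (j.+1)%:Z%R s ->
  (forall n F G (v e : 'I_n -> P), F < G -> polygon_labelling rk F G v e ->
     rk F = (j%:Z - 1)%R -> rk G = (j%:Z + 2)%R -> (2 < n)%N) ->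
  linked (a, b, c, z) (rr j (rr j.+1 (a, b, c, z))) \/ linked (a, b, c, z) (rr j.+1 (rr j (a,
    b, c, z))).
Proof.
move=> qf j3 [sA sfix scyc] big; set q := (a, b, c, z).
case/quad_flagP: qf => [[ra rb rc rz] ab bc cz].
have [bq aq bq' cq [zq tq]] : [/\ bot \in quad_set q, a \in quad_set q, b \in quad_set q,
    c \in quad_set q & z \in quad_set q /\ top \in quad_set q].
  by do !split; rewrite !inE eqxx ?orbT.
have ba : bot < a by rewrite bot_lt ?ra.
have zt : z < top by rewrite lt_top ?rz.
have sbot := aut_bot sA; have stop := aut_top sA.
have ss : linked q (quad_map s q) by exists s.
case: j j3 sfix scyc big => [|[|[|]]] // _ sfix scyc big.
- have sc : s c = c by apply: sfix; rewrite ?rc.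
  have sz : s z = z by apply: sfix; rewrite ?rz.
  have [n [v [e [lab se]]]] := scyc bot c bq cq bot_rk rc.
  have n2 := big _ _ _ _ _ (lt_trans ba (lt_trans ab bc)) lab bot_rk rc.
  have := section_rotation_other n2 lab se sA sbot sc ba ab bc.
  rewrite ra rb rc bot_rk => /(_ erefl erefl erefl) E.
  move: ss; rewrite /q /= sc sz; case: E => -[E1 E2]; [right|left]; by rewrite /= -E1 -E2.
- have sa : s a = a by apply: sfix; rewrite ?ra.
  have sz : s z = z by apply: sfix; rewrite ?rz.
  have [n [v [e [lab se]]]] := scyc a z aq zq ra rz.
  have n2 := big _ _ _ _ _ (lt_trans ab (lt_trans bc cz)) lab ra rz.
  have := section_rotation_other n2 lab se sA sa sz ab bc cz.
  rewrite ra rb rc rz => /(_ erefl erefl erefl) E.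
  move: ss; rewrite /q /= sa sz; case: E => -[E1 E2]; [right|left]; by rewrite /= -E1 -E2.
have sa : s a = a by apply: sfix; rewrite ?ra.
have sb : s b = b by apply: sfix; rewrite ?rb.
have [n [v [e [lab se]]]] := scyc b top bq' tq rb top_rk.
have n2 := big _ _ _ _ _ (lt_trans bc (lt_trans cz zt)) lab rb top_rk.
have := section_rotation_other n2 lab se sA sb stop bc cz zt.
rewrite rb rc rz top_rk => /(_ erefl erefl erefl) E.
move: ss; rewrite /q /= sa sb; case: E => -[E1 E2]; [right|left]; by rewrite /= -E1 -E2.
Qed.


Variable m : nat.
Hypothesis ty : has_type rk 3 m 3.

(** * Triangular sections *)

Definition tri_inc (i k : 'I_3) := (i == k) || (i == ordS k).

Lemma tri_meet (k l : 'I_3) : k != l -> exists i,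
  [/\ tri_inc i k, tri_inc i l & forall j, tri_inc j k -> tri_inc j l -> j = i].
Proof.
move=> kl; suff [i /and3P[ik il /forallP iU]] : exists i, [&& tri_inc i k, tri_inc i l &
    [forall j, tri_inc j k ==> tri_inc j l ==> (j == i)]].
  by exists i; split=> // j jk jl; apply/eqP; have := iU j; rewrite jk jl.
by case: k l kl => -[|[|[|k]]] ? [[|[|[|l]]] ?] // _;
  first [by exists (@Ordinal 3 0 isT); apply/and3P; split=> //; apply/forallP=> -[[|[|[|j]]] ?]
   | by exists (@Ordinal 3 1 isT); apply/and3P; split=> //; apply/forallP=> -[[|[|[|j]]] ?]
   | by exists (@Ordinal 3 2 isT); apply/and3P; split=> //; apply/forallP=> -[[|[|[|j]]] ?]].
Qed.

Lemma tri_join (i j : 'I_3) : i != j -> exists k,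
  [/\ tri_inc i k, tri_inc j k & forall l, tri_inc i l -> tri_inc j l -> l = k].
Proof.
move=> ij; suff [k /and3P[ik il /forallP iU]] : exists k, [&& tri_inc i k, tri_inc j k &
    [forall l, tri_inc i l ==> tri_inc j l ==> (l == k)]].
  by exists k; split=> // l jk jl; apply/eqP; have := iU l; rewrite jk jl.
by case: i j ij => -[|[|[|k]]] ? [[|[|[|l]]] ?] // _;
  first [by exists (@Ordinal 3 0 isT); apply/and3P; split=> //; apply/forallP=> -[[|[|[|j]]] ?]
   | by exists (@Ordinal 3 1 isT); apply/and3P; split=> //; apply/forallP=> -[[|[|[|j]]] ?]
   | by exists (@Ordinal 3 2 isT); apply/and3P; split=> //; apply/forallP=> -[[|[|[|j]]] ?]].
Qed.

Lemma triangle_facts (F G : P) : is_polygon rk 3 F G ->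
  [/\ #|[set x | (rk x == rk F + 1)%R && (F < x < G)]| = 3,
      #|[set x | (rk x == rk F + 2)%R && (F < x < G)]| = 3,
      forall x y, rk x = (rk F + 2)%R -> rk y = (rk F + 2)%R -> F < x < G -> F < y < G -> x != y ->
        exists p, [/\ rk p = (rk F + 1)%R, F < p, p < x, p < y &
          forall p', rk p' = (rk F + 1)%R -> F < p' -> p' < x -> p' < y -> p' = p]
    & forall x y, rk x = (rk F + 1)%R -> rk y = (rk F + 1)%R -> F < x < G -> F < y < G -> x != y ->
        exists p, [/\ rk p = (rk F + 2)%R, p < G, x < p, y < p &
          forall p', rk p' = (rk F + 2)%R -> p' < G -> x < p' -> y < p' -> p' = p]].
Proof.
move=> [v [e [vI eI vP eP inc]]].
have card (f : 'I_3 -> P) r : injective f ->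
    (forall x, (F < x < G /\ rk x = r) <-> exists i, x = f i) ->
    #|[set x | (rk x == r) && (F < x < G)]| = 3.
  move=> fI fP; rewrite -[RHS](card_ord 3) -(card_imset predT fI); congr #|pred_of_set _|.
  apply/setP=> x; rewrite inE; apply/andP/imsetP => [[/eqP rx xS]|[i _ xE]].
    by have [i ->] : exists i, x = f i; [apply/fP | exists i].
  by have [-> ->] : F < x < G /\ rk x = r by apply/fP; exists i.
have incE i k : (v i < e k) = tri_inc i k by rewrite inc.
have vS i : F < v i < G /\ rk (v i) = (rk F + 1)%R by apply/vP; exists i.
have eS k : F < e k < G /\ rk (e k) = (rk F + 2)%R by apply/eP; exists k.
split; [exact: card vI vP | exact: card eI eP | |].
- move=> x y rx ry xS yS; have [k ->] : exists k, x = e k by apply/eP.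
  have [l ->] : exists k, y = e k by apply/eP.
  rewrite (inj_eq eI) => /tri_meet[i [ik il iU]]; exists (v i); rewrite !incE.
  have [/andP[Fv _] rv] := vS i; split=> // p rp Fp pk pl.
  have [j E] : exists j, p = v j.
    by apply/vP; rewrite Fp; have [/andP[_ eG] _] := eS k; rewrite (lt_trans pk eG).
  by rewrite E (iU j) // -incE -E.
move=> x y rx ry xS yS; have [i ->] : exists k, x = v k by apply/vP.
have [j ->] : exists k, y = v k by apply/vP.
rewrite (inj_eq vI) => /tri_join[k [ik il iU]]; exists (e k); rewrite !incE.
have [/andP[_ eG] re] := eS k; split=> // p rp Fp pk pl.
have [l E] : exists j, p = e j.
  by apply/eP; rewrite Fp; have [/andP[Fv _] _] := vS i; rewrite (lt_trans Fv pk).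
by rewrite E (iU l) // -incE -E.
Qed.

(** * The medial layer graph *)

Local Notation V := (medial_vertex rk).
Local Notation E := (medial_layer_graph rk).

Lemma medial_rk (x : V) : rk (val x) = 1%R \/ rk (val x) = 2%R.
Proof. by case/orP: (valP x) => /eqP; [left|right]. Qed.

Lemma medial_ex1 x : rk x = 1%R -> exists u : V, val u = x.
Proof. by move=> rx; have h : (rk x == 1%R) || (rk x == 2%R); [rewrite rx | exists (Sub x h)]. Qed.

Lemma medial_ex2 x : rk x = 2%R -> exists u : V, val u = x.
Proof. by move=> rx; have h : (rk x == 1%R) || (rk x == 2%R); [rewrite rx orbT |
  exists (Sub x h)]. Qed.

Lemma E_sym : symmetric E.
Proof. by move=> x y; rewrite /medial_layer_graph /= orbC. Qed.

Lemma E12 (x y : V) : rk (val x) = 1%R -> E x y = (rk (val y) == 2%R) && (val x < val y).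
Proof.
move=> rx; rewrite /medial_layer_graph /=; have [ry|ry] := medial_rk y; rewrite ry /=.
  by apply/negP=> /orP[]/rk_lt; rewrite rx ry.
by rewrite orbC; case: (boolP (val y < val x)) => // /rk_lt; rewrite rx ry.
Qed.

Lemma E21 (x y : V) : rk (val x) = 2%R -> E x y = (rk (val y) == 1%R) && (val y < val x).
Proof.
move=> rx; rewrite /medial_layer_graph /=; have [ry|ry] := medial_rk y; rewrite ry /=.
  by case: (boolP (val x < val y)) => // /rk_lt; rewrite rx ry.
by apply/negP=> /orP[]/rk_lt; rewrite rx ry.
Qed.

(* Treats the vertices of a 1-face and the facets on a 2-face uniformly. *)
Definition tip (p : P) (x : V) : Prop :=
  [/\ rk (val x) = 1%R, rk p = 0%R & p < val x] \/
  [/\ rk (val x) = 2%R, rk p = 3%R & val x < p].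

Lemma tip1 p (x : V) : rk (val x) = 1%R -> tip p x -> rk p = 0%R /\ p < val x.
Proof. by move=> rx [[]|[]] //; rewrite rx. Qed.
Lemma tip2 p (x : V) : rk (val x) = 2%R -> tip p x -> rk p = 3%R /\ val x < p.
Proof. by move=> rx [[]|[]] //; rewrite rx. Qed.

Lemma tri_below c : rk c = 2%R -> is_polygon rk 3 bot c.
Proof.
move=> rc; have bc : bot < c by rewrite bot_lt ?rc.
by have [H _ _] := ty bc; apply: H.
Qed.

Lemma tri_above b : rk b = 1%R -> is_polygon rk 3 b top.
Proof.
move=> rb; have bt : b < top by rewrite lt_top ?rb.
by have [_ _ H] := ty bt; apply: H.
Qed.

Lemma E_cubic x : #|[set y | E x y]| = 3.
Proof.
rewrite -(card_imset _ val_inj); have [rx|rx] := medial_rk x.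
  have [H _ _ _] := triangle_facts (tri_above rx); rewrite -H.
  congr #|pred_of_set _|; apply/setP=> p; rewrite inE; apply/imsetP/idP.
    move=> [y]; rewrite inE E12 // => /andP[/eqP ry xy] ->.
    by rewrite ry rx xy lt_top ?ry.
  case/andP=> /eqP rp /andP[xp _]; rewrite rx in rp.
  have [y yE] := medial_ex2 rp; exists y => //; rewrite inE E12 // yE rp xp //.
have [_ H _ _] := triangle_facts (tri_below rx); rewrite -H.
congr #|pred_of_set _|; apply/setP=> p; rewrite inE; apply/imsetP/idP.
  move=> [y]; rewrite inE E21 // => /andP[/eqP ry xy] ->.
  by rewrite ry bot_rk xy bot_lt ?ry.
case/andP=> /eqP rp /andP[_ xp]; rewrite bot_rk in rp.
have [y yE] := medial_ex1 rp; exists y => //; rewrite inE E21 // yE rp xp //.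
Qed.

Lemma E_has_nb (x : V) : exists y, E x y.
Proof.
have : [set y | E x y] != set0 by rewrite -card_gt0 E_cubic.
by case/set0Pn=> y; rewrite inE; exists y.
Qed.

Lemma tip_two_lines p (b c : V) : tip p b -> E b c ->
  exists b', [/\ b' != b, E b' c, tip p b'
    & forall b'', E b'' c -> tip p b'' -> b'' = b \/ b'' = b'].
Proof.
have [rb|rb] := medial_rk b.
  move=> /(tip1 rb)[rp pb]; rewrite E12 // => /andP[/eqP rc bc].
  have [|||o1 /andP[o2 o3] o4 U] := @otherP p (val b) (val c); rewrite ?pb ?rp ?rb ?rc //.
  rewrite rb in o1; have [b' E'] := medial_ex1 o1; exists b'.
  split; first by rewrite -(inj_eq val_inj) E'.
  - by rewrite E12 E' // rc o3.
  - by left; rewrite E'.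
  move=> b''; rewrite E_sym E21 // => /andP[/eqP rb'' bc''] /(tip1 rb'')[_ pb''].
  have [->|ne] := eqVneq b'' b; first by left.
  by right; apply: val_inj; rewrite E'; apply: U; rewrite ?rb ?pb'' ?(inj_eq val_inj).
move=> /(tip2 rb)[rp pb]; rewrite E21 // => /andP[/eqP rc bc].
have [|||o1 /andP[o2 o3] o4 U] := @otherP (val c) (val b) p; rewrite ?pb ?rp ?rb ?rc ?bc //.
rewrite rb in o1; have [b' E'] := medial_ex2 o1; exists b'.
split; first by rewrite -(inj_eq val_inj) E'.
- by rewrite E21 E' // rc o2.
- by right; rewrite E'.
move=> b''; rewrite E_sym E12 // => /andP[/eqP rb'' bc''] /(tip2 rb'')[_ pb''].
have [->|ne] := eqVneq b'' b; first by left.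
by right; apply: val_inj; rewrite E'; apply: U; rewrite ?rb ?pb'' ?bc'' ?(inj_eq val_inj).
Qed.

Lemma tip_meet (c b1 b2 : V) : E b1 c -> E b2 c -> b1 != b2 ->
  exists p, [/\ tip p b1, tip p b2 & forall p', tip p' b1 -> tip p' b2 -> p' = p].
Proof.
rewrite ![E _ c]E_sym; have [rc|rc] := medial_rk c.
  rewrite !E12 // => /andP[/eqP r1 c1] /andP[/eqP r2 c2]; rewrite -(inj_eq val_inj) => ne.
  have [_ _ _ H] := triangle_facts (tri_above rc); rewrite rc in H.
  have [||p [rp pt p1 p2 U]] := H _ _ r1 r2 _ _ ne; rewrite ?c1 ?c2 ?lt_top ?r1 ?r2 //.
  exists p; split; [by right|by right|].
  move=> p' /(tip2 r1)[rp' p1'] /(tip2 r2)[_ p2']; apply: U => //.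
  by rewrite lt_top ?rp'.
rewrite !E21 // => /andP[/eqP r1 c1] /andP[/eqP r2 c2]; rewrite -(inj_eq val_inj) => ne.
have [_ _ H _] := triangle_facts (tri_below rc); rewrite bot_rk in H.
have [||p [rp pt p1 p2 U]] := H _ _ r1 r2 _ _ ne; rewrite ?c1 ?c2 ?bot_lt ?r1 ?r2 //.
exists p; split; [by left|by left|].
move=> p' /(tip1 r1)[rp' p1'] /(tip1 r2)[_ p2']; apply: U => //.
by rewrite bot_lt ?rp'.
Qed.

Lemma quad_above (a b : P) : rk a = 0%R -> rk b = 1%R -> a < b -> exists c z, quad_flag (a,
  b, c, z).
Proof.
move=> ra rb ab; have bt : b < top by rewrite lt_top ?rb.
have [c /andP[bc ct] rc] := cover_up bt; rewrite rb in rc.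
have ct' : c < top by rewrite lt_top ?rc.
have [z /andP[cz _] rz] := cover_up ct'; rewrite rc in rz.
by exists c, z; apply/quad_flagP.
Qed.

Lemma quad_below (c z : P) : rk c = 2%R -> rk z = 3%R -> c < z -> exists a b, quad_flag (a,
  b, c, z).
Proof.
move=> rc rz cz; have bt : bot < c by rewrite bot_lt ?rc.
have [b /andP[_ bc] rb] := cover_down bt; rewrite rc in rb.
have bb : bot < b by rewrite bot_lt ?rb.
have [a /andP[_ ab] ra] := cover_down bb; rewrite rb in ra.
by exists a, b; apply/quad_flagP.
Qed.

(** This is flag-connectedness of the section between [p] and [top], or [bot] and [p]: along its
    flags the middle face on [p] changes only while the other middle face stays fixed. *)
Lemma tip_residue_ind (Q : V -> Prop) p :
  (forall b b' c, tip p b -> tip p b' -> E b c -> E b' c -> Q b -> Q b') ->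
  forall b b', tip p b -> tip p b' -> Q b -> Q b'.
Proof.
move=> H b b'; have [rb|rb] := medial_rk b.
  move=> tb; have [rp pb] := tip1 rb tb; case=> [[rb' _ pb']|[_]]; last by rewrite rp.
  have [c [z qf]] := quad_above rp rb pb; have [c' [z' qf']] := quad_above rp rb' pb'.
  (* [Q] speaks of vertices of the graph, so the predicate on flags quantifies over the vertices
     with value [b]. *)
  pose Q' (q : quad) := let: (a, b, c, z) := q in forall x : V, val x = b -> Q x.
  have qw : quad_within p top (p, val b, c, z) by rewrite /quad_within qf lexx le_top.
  have qw' : quad_within p top (p, val b', c', z') by rewrite /quad_within qf' lexx le_top.
  move=> Qb; suff /(_ b' erefl) : Q' (p, val b', c', z') by [].
  apply: (@section_ind p top Q' _ _ _ _ _ _ _ _ _ qw qw') => //; rewrite ?rp ?top_rk //.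
    move=> a b1 b2 c1 z1 /and3P[/quad_flagP[[ra rb1 rc1 _] ab1 bc1 _] pa _].
    move=> /and3P[/quad_flagP[[_ rb2 _ _] ab2 bc2 _] _ _] Q1 x xE.
    have [y yE] := medial_ex1 rb1; have [w wE] := medial_ex2 rc1.
    apply: (H y x w _ _ _ _ (Q1 y yE)); rewrite ?E12 ?xE ?yE ?wE ?rc1 ?bc1 ?bc2 //; left;
      by rewrite ?xE ?yE (le_lt_trans pa).
  by move=> x /val_inj->.
move=> tb; have [rp pb] := tip2 rb tb; case=> [[_]|[rb' _ pb']]; first by rewrite rp.
have [a [e qf]] := quad_below rb rp pb; have [a' [e' qf']] := quad_below rb' rp pb'.
pose Q' (q : quad) := let: (a, b, c, z) := q in forall x : V, val x = c -> Q x.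
have qw : quad_within bot p (a, e, val b, p) by rewrite /quad_within qf lexx bot_le.
have qw' : quad_within bot p (a', e', val b', p) by rewrite /quad_within qf' lexx bot_le.
move=> Qb; suff /(_ b' erefl) : Q' (a', e', val b', p) by [].
apply: (@section_ind bot p Q' _ _ _ _ _ _ _ _ _ qw qw') => //; rewrite ?rp ?bot_rk //.
  move=> a1 b1 c1 c2 z1 /and3P[/quad_flagP[[_ rb1 rc1 _] _ bc1 cz1] _ zp].
  move=> /and3P[/quad_flagP[[_ _ rc2 _] _ bc2 cz2] _ _] Q1 x xE.
  have [y yE] := medial_ex2 rc1; have [w wE] := medial_ex1 rb1.
  apply: (H y x w _ _ _ _ (Q1 y yE)); rewrite ?E21 ?xE ?yE ?wE ?rb1 ?bc1 ?bc2 //; right;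
    by rewrite ?xE ?yE (lt_le_trans _ zp).
by move=> x /val_inj->.
Qed.

Lemma quad_through (b c : P) : rk b = 1%R -> rk c = 2%R -> b < c -> exists a z, quad_flag (a,
  b, c, z).
Proof.
move=> rb rc bc; have bb : bot < b by rewrite bot_lt ?rb.
have ct : c < top by rewrite lt_top ?rc.
have [a /andP[_ ab] ra] := cover_down bb; rewrite rb in ra.
have [z /andP[cz _] rz] := cover_up ct; rewrite rc in rz.
by exists a, z; apply/quad_flagP.
Qed.

Lemma E_quad (x y : V) : E x y -> exists a b c z, quad_flag (a, b, c, z) /\
  (val x = b /\ val y = c \/ val x = c /\ val y = b).
Proof.
have [rx|rx] := medial_rk x.
  rewrite E12 // => /andP[/eqP ry xy]; have [a [z qf]] := quad_through rx ry xy.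
  by exists a, (val x), (val y), z; split=> //; left.
rewrite E21 // => /andP[/eqP ry xy]; have [a [z qf]] := quad_through ry rx xy.
by exists a, (val y), (val x), z; split=> //; right.
Qed.

(** Each of [r0], ..., [r3] keeps at least one of the two middle faces, so moving along flags never
    leaves a component. *)
Lemma E_conn x y : connect E x y.
Proof.
have [x' xx'] := E_has_nb x; have [y' yy'] := E_has_nb y.
have [a [b [c [z [qf H]]]]] := E_quad xx'; have [a' [b' [c' [z' [qf' H']]]]] := E_quad yy'.
pose Q (q : quad) := let: (a, b, c, z) := q in forall u : V, val u = b \/ val u = c ->
  connect E x u.
suff : Q (a', b', c', z').
  by apply; case: H' => -[-> _]; [left|right].
have Eval (u w : V) b1 c1 : rk b1 = 1%R -> rk c1 = 2%R -> b1 < c1 -> val u = b1 ->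
  val w = c1 -> E u w.
  by move=> rb rc bc ub wc; rewrite E12 ?ub // wc rc bc.
apply: (@flag_ind Q _ (a, b, c, z)) => //.
  move=> [[[a1 b1] c1] z1] q1f Q1.
  have [[_ [o1 /andP[_ o2] _] [o3 /andP[o4 _] _] _] _] := quad_others q1f.
  case/quad_flagP: q1f => [[ra rb rc rz] ab bc cz].
  have [u uE] := medial_ex1 rb; have [w wE] := medial_ex2 rc.
  split=> //= t [tE|tE]; try by [apply: Q1; left | apply: Q1; right].
    apply: (connect_trans (Q1 w (or_intror wE))); apply: connect1; rewrite E_sym.
    exact: Eval o1 rc o2 tE wE.
  apply: (connect_trans (Q1 u (or_introl uE))); apply: connect1.
  exact: Eval rb o3 o4 uE tE.
move=> u uE; have [-> | ->] : u = x \/ u = x'; last exact: connect1; last exact: connect0.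
by case: H uE => -[h1 h2] [] uE; [left|right|right|left]; apply: val_inj; rewrite uE.
Qed.


(** * Restriction of polytope automorphisms to the graph *)

Lemma aut_restrict g : poset_aut g -> exists h : {perm V}, forall x, val (h x) = g (val x).
Proof.
move=> gA; pose f (x : V) : V := insubd x (g (val x)).
have fE x : val (f x) = g (val x).
  by rewrite insubdK // -topredE /= aut_rk //; exact: (valP x).
have fI : injective f by move=> x y /(congr1 val); rewrite !fE => /perm_inj/val_inj.
by exists (perm fI) => x; rewrite permE.
Qed.

Lemma restrict_aut g (h : {perm V}) : poset_aut g -> (forall x, val (h x) = g (val x)) ->
  graph_aut E h.
Proof. by move=> gA hE x y; rewrite /medial_layer_graph /= !hE !aut_lt. Qed.

Lemma tip_aut g (h : {perm V}) p x : poset_aut g -> (forall x, val (h x) = g (val x)) ->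
  tip p x -> tip (g p) (h x).
Proof. by move=> gA hE; rewrite /tip hE !aut_rk // !aut_lt. Qed.

(** If [h] interchanged [y] and [h y], then [g p] would be their unique common tip, which is [p]. So
    [h] permutes the three neighbours of [x] cyclically, and the cube of [g] fixes [p]. *)
Lemma three_cycle g (h : {perm V}) p x y : poset_aut g -> (forall x, val (h x) = g (val x)) ->
  h x = x -> E x y -> h y != y -> tip p y -> tip p (h y) -> g p <> p ->
  [/\ forall w, E x w -> h w != w, h (h (h y)) = y & g (g (g p)) = p].
Proof.
move=> gA hE hx xy hy py phy gp; have hA := restrict_aut gA hE.
have xe w : E x w -> E x (h w) by move=> xw; rewrite -hx hA.
have xhy := xe _ xy; have yhy : y != h y by rewrite eq_sym.
have tipA p' w := @tip_aut g h p' w gA hE.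
have [q [_ _ U]] := tip_meet (etrans (E_sym _ _) xy) (etrans (E_sym _ _) xhy) yhy.
have pq := U _ py phy.
have hhy : h (h y) != y.
  apply/eqP=> E'; case: gp; rewrite [RHS]pq; apply: U; last exact: (tipA _ _).
  by rewrite -E'; apply: (tipA _ _).
have [w [xw wy why H]] := third E_cubic xy xhy yhy.
have E1 : h (h y) = w.
  by case/or3P: (H _ (xe _ xhy)) => /eqP // /eqP;
    rewrite ?(negPf hhy) // (inj_eq perm_inj) (negPf hy).
have E2 : h w = y.
  case/or3P: (H _ (xe _ xw)) => /eqP // /eqP.
    by rewrite (inj_eq perm_inj) (negPf wy).
  by rewrite -[X in _ == X]E1 (inj_eq perm_inj) (negPf why).
split; last 1 first.
- rewrite [RHS]pq; apply: U.
    have -> : y = h (h (h y)) by rewrite E1 E2.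
    by do 3 apply: (tipA _ _).
  have -> : h y = h (h (h (h y))) by rewrite E1 E2.
  by do 3 apply: (tipA _ _).
- move=> u /H /or3P[]/eqP-> //; first by rewrite (inj_eq perm_inj).
  by rewrite E2 eq_sym.
by rewrite E1 E2.
Qed.

(** Keeping [g] beside its restriction [h] retains the action on tips, which are not vertices of the
    graph. *)
Definition rotpair x g (h : {perm V}) :=
  [/\ poset_aut g, forall y, val (h y) = g (val y), rotation3 E x h & forall p, tip p x -> g p = p].

Lemma rotpairV x g h : rotpair x g h -> rotpair x g^-1%g h^-1%g.
Proof.
case=> gA hE hr gt; split; [exact: poset_autV | | exact: rotation3V | ].
  by move=> y; apply: (@perm_inj _ g); rewrite -hE !permKV.
by move=> p /gt gp; rewrite -{1}gp permK.
Qed.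

Lemma graph_aut_in f : graph_aut E f -> f \in aut_group E.
Proof. by move=> fA; apply/aut_setP. Qed.

Lemma graph_aut1 : graph_aut E 1%g.
Proof. by move=> x y; rewrite !perm1. Qed.

Lemma graph_autV f : graph_aut E f -> graph_aut E f^-1%g.
Proof. by move=> fA x y; rewrite -fA !permKV. Qed.

(** * Extension of graph automorphisms to the polytope *)

Lemma tip_exists p : rk p = 0%R \/ rk p = 3%R -> exists b, tip p b.
Proof.
case=> rp.
  have pt : p < top by rewrite lt_top ?rp.
  have [b /andP[pb _] rb] := cover_up pt; rewrite rp in rb.
  by have [u uE] := medial_ex1 rb; exists u; left; rewrite uE.
have bp : bot < p by rewrite bot_lt ?rp.
have [c /andP[_ cp] rc] := cover_down bp; rewrite rp in rc.
by have [u uE] := medial_ex2 rc; exists u; right; rewrite uE.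
Qed.

Lemma tip_images f : graph_aut E f -> keeps_straight E tip f ->
  exists phi : P -> P, forall p b, tip p b -> tip (phi p) (f b).
Proof.
move=> fA fs; apply: (@fin_all_exists P (fun _ => P) (fun p p' => forall b, tip p b ->
  tip p' (f b))) => p.
have [rp|rp] : (rk p = 0%R \/ rk p = 3%R) \/ ~ (rk p = 0%R \/ rk p = 3%R).
  have [|n0] := eqVneq (rk p) 0%R; first by left; left.
  have [|n3] := eqVneq (rk p) 3%R; first by left; right.
  by right=> -[] /eqP; [rewrite (negPf n0) | rewrite (negPf n3)].
  have [b0 pb0] := tip_exists rp.
  exact: point_image tip_two_lines tip_meet tip_residue_ind E_has_nb _ _ _ fA fs pb0.
(* A face of any other rank is a tip of no vertex, so its value is arbitrary. *)
by exists p => b [[_ H _]|[_ H _]]; case: rp; [left|right].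
Qed.

(** By finiteness the inverse of [g] is a power of [g], hence monotone as well. *)
Lemma mono_perm_aut (g : {perm P}) : (forall x y, x <= y -> g x <= g y) -> poset_aut g.
Proof.
move=> gm x y; apply/idP/idP; last exact: gm.
have km n (u w : P) : u <= w -> (g ^+ n)%g u <= (g ^+ n)%g w.
  elim: n => [|n IH] uw; first by rewrite expg0 !perm1.
  by rewrite expgSr !permM; apply: (gm _ _); exact: IH.
move/(km #[g]%g.-1); rewrite -!permM -!expgS prednK ?order_gt0 // expg_order.
by rewrite !perm1.
Qed.

Lemma anti_perm_duality (g : {perm P}) : (forall x y, x <= y -> g y <= g x) -> poset_duality g.
Proof.
move=> gm x y; apply/idP/idP; last exact: gm.
have ggA : poset_aut (g * g)%g by apply: mono_perm_aut => u w uw; rewrite !permM;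
  apply: (gm _ _); exact: gm.
by move/gm; rewrite -!permM ggA.
Qed.

Definition flip_rk (s : bool) (r : int) : int := if s then (3 - r)%R else r.

Lemma flip_rkK s r r' : flip_rk s r = flip_rk s r' -> r = r'.
Proof. by case: s; rewrite /flip_rk //; lia. Qed.

(** [F] is [f] on ranks 1 and 2, the tip map [phi] on ranks 0 and 3, and fixes or exchanges [bot]
    and [top]. It is injective because the tip map of the inverse of [f] undoes [phi], and it
    respects covers, hence all strict inequalities. *)
Lemma medial_extend (s : bool) f : graph_aut E f -> keeps_straight E tip f ->
  keeps_straight E tip f^-1%g -> (forall x, rk (val (f x)) = flip_rk s (rk (val x))) ->
  exists2 F : {perm P}, forall u, F (val u) = val (f u) &
    if s then poset_duality F else poset_aut F.
Proof.
move=> fA fs fsV frk.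
have [phi phiP] := tip_images fA fs; have [psi psiP] := tip_images (graph_autV fA) fsV.
pose F x := if insub x is Some u then val (f u : V)
  else if x == bot then (if s then top else bot)
  else if x == top then (if s then bot else top) else phi x.
have Fval u : F (val u) = val (f u) by rewrite /F valK.
have Fout x : rk x <> 1%R -> rk x <> 2%R -> F x = if x == bot then (if s then top else bot)
  else if x == top then (if s then bot else top) else phi x.
  by move=> n1 n2; rewrite /F insubN // negb_or; apply/andP; split; apply/eqP.
have Fbot : F bot = if s then top else bot by rewrite Fout ?bot_rk // eqxx.
have bt : bot == top = false by apply/negP=> /eqP bt; move: bot_rk; rewrite bt top_rk.
have Ftop : F top = if s then bot else top by rewrite Fout ?top_rk // eq_sym bt eqxx.
have Fphi x : rk x = 0%R \/ rk x = 3%R -> F x = phi x.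
  move=> rx; rewrite Fout; [|by case: rx => ->|by case: rx => ->].
  by do 2 (case: eqP => [E'|_]; first by move: rx; rewrite E' ?bot_rk ?top_rk; case).
have cases x : [\/ rk x = (-1)%R \/ rk x = 4%R, rk x = 0%R \/ rk x = 3%R, rk x = 1%R | rk x = 2%R].
  have := rk_range x => H; have : rk x = (-1)%R \/ rk x = 0%R \/ rk x = 1%R \/ rk x = 2%R \/
    rk x = 3%R \/ rk x = 4%R.
    by clear - H; lia.
  by case=> [|[|[|[|[|]]]]]; [constructor 1; left|constructor 2;
    left|constructor 3|constructor 4|constructor 2; right|constructor 1; right].
have tip_rk p b : tip p b -> rk p = 0%R /\ rk (val b) = 1%R \/ rk p = 3%R /\ rk (val b) = 2%R.
  by case=> -[]; [left|right].
have Frk x : rk (F x) = flip_rk s (rk x).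
  case: (cases x) => [[/rk_bot->|/rk_top->]|rx|rx|rx].
  - by rewrite Fbot bot_rk; case: (s); rewrite ?bot_rk ?top_rk.
  - by rewrite Ftop top_rk; case: (s); rewrite ?bot_rk ?top_rk.
  - have [b xb] := tip_exists rx; rewrite Fphi //; have := tip_rk _ _ (phiP _ _ xb).
    rewrite frk; case: (tip_rk _ _ xb) => -[-> ->]; case: (s) => -[[-> H]|[-> H]] //;
      move: H; rewrite /flip_rk; lia.
  - by have [u <-] := medial_ex1 rx; rewrite Fval frk.
  by have [u <-] := medial_ex2 rx; rewrite Fval frk.
have phiI x y : rk x = 0%R \/ rk x = 3%R -> rk y = 0%R \/ rk y = 3%R -> phi x = phi y -> x = y.
  have main w : rk w = 0%R \/ rk w = 3%R -> w = psi (phi w).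
    move=> /tip_exists[b wb]; apply: (point_image_uniq tip_two_lines tip_meet E_has_nb
      graph_aut1 wb).
      by move=> u; rewrite perm1.
    by move=> u wu; rewrite perm1 -[u](permK f); apply/psiP/phiP.
  by move=> rx ry E'; rewrite (main x) // E' -main.
have FI : injective F.
  move=> x y FE; have /flip_rkK rE : flip_rk s (rk x) = flip_rk s (rk y) by rewrite -!Frk FE.
  case: (cases x) => [[rx|rx]|rx|rx|rx].
  - by rewrite (rk_bot rx) [RHS]rk_bot // -rE.
  - by rewrite (rk_top rx) [RHS]rk_top // -rE.
  - by move: FE; rewrite !Fphi -?rE //; apply: phiI; rewrite -?rE.
  - have [u uE] := medial_ex1 rx; rewrite rE in rx; have [w wE] := medial_ex1 rx.
    by move: FE; rewrite -uE -wE !Fval => /val_inj/perm_inj->.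
  have [u uE] := medial_ex2 rx; rewrite rE in rx; have [w wE] := medial_ex2 rx.
  by move: FE; rewrite -uE -wE !Fval => /val_inj/perm_inj->.
(* The order that [F] must respect, reversed for a duality, so that both cases share one proof. *)
pose below (x y : P) := if s then y < x else x < y.
have below_trans x y z : below x y -> below y z -> below x z.
  by rewrite /below; case: (s) => h1 h2; [exact: lt_trans h2 h1 | exact: lt_trans h1 h2].
have tip_below p b : tip p b -> rk p = 0%R -> below (phi p) (val (f b)).
  move=> pb rp; have := phiP _ _ pb; have [_ rb] : rk p = 0%R /\ rk (val b) = 1%R.
    by case: (tip_rk _ _ pb) => -[]; rewrite rp.
  by case=> -[]; rewrite frk rb /below; case: (s).
have tip_above p b : tip p b -> rk p = 3%R -> below (val (f b)) (phi p).
  move=> pb rp; have := phiP _ _ pb; have [_ rb] : rk p = 3%R /\ rk (val b) = 2%R.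
    by case: (tip_rk _ _ pb) => -[]; rewrite rp.
  by case=> -[]; rewrite frk rb /below; case: (s).
have cover x y : x < y -> rk y = (rk x + 1)%R -> below (F x) (F y).
  move=> xy; case: (cases x) => [[rx|rx]|[rx|rx]|rx|rx]; rewrite rx => ry.
  - rewrite (rk_bot rx) Fbot /below; have := Frk y; rewrite ry /flip_rk; case: (s) => H.
      by rewrite lt_top ?H.
    by rewrite bot_lt ?H.
  - by have := rk_range y; rewrite ry.
  - have [u uE] := medial_ex1 ry; rewrite -uE Fval Fphi; last by left.
    by apply: tip_below => //; left; rewrite uE.
  - rewrite (rk_top ry) Ftop /below; have := Frk x; rewrite rx /flip_rk; case: (s) => H.
      by rewrite bot_lt ?H.
    by rewrite lt_top ?H.
  - have [u uE] := medial_ex1 rx; have [w wE] := medial_ex2 ry.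
    have : E u w by rewrite E12 uE // wE ry xy.
    rewrite -fA -uE -wE !Fval /below; have := frk u; rewrite uE rx /flip_rk; case: (s) => H.
      by rewrite E21 ?H // => /andP[].
    by rewrite E12 ?H // => /andP[].
  have [u uE] := medial_ex2 rx; rewrite -uE Fval Fphi; last by right.
  by apply: tip_above => //; right; rewrite uE.
have lt_below x y : x < y -> below (F x) (F y).
  have [n] : exists n : nat, (rk y <= rk x + n%:Z)%R.
    by exists (absz (rk y - rk x)%R); lia.
  elim: n x => [|n IH] x ryn xy; first by have := rk_lt xy; move: ryn; rewrite addr0 leNgt =>
    /negPf->.
  have [z /andP[xz zy] rz] := cover_up xy; have H := cover _ _ xz rz.
  move: zy; rewrite le_eqVlt => /predU1P[<-//|zy].
  by apply: below_trans H (IH _ _ zy); rewrite rz; clear - ryn; lia.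
have FE : perm FI =1 F by exact: permE.
exists (perm FI) => [u|]; first by rewrite FE Fval.
move: lt_below; rewrite /below; case: (s) => H.
  apply: anti_perm_duality => x y; rewrite le_eqVlt => /predU1P[->//|/H].
  by rewrite !FE; exact: ltW.
apply: mono_perm_aut => x y; rewrite le_eqVlt => /predU1P[->//|/H].
by rewrite !FE; exact: ltW.
Qed.

(** A flag [(a, b, c, z)] yields the 3-arc [other a b c], [c], [b], [other b c z], and [a] and [z]
    are recovered as the common tips of its vertices two steps apart. Matching two such arcs
    therefore matches the flags. *)
Lemma regular_of_three_arcs :
  (forall x0 x1 x2 x3 y0 y1 y2 y3 : V, rk (val x0) = 1%R -> rk (val y0) = 1%R ->
    [/\ E x0 x1, E x1 x2, E x2 x3, x0 != x2 & x1 != x3] ->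
    [/\ E y0 y1, E y1 y2, E y2 y3, y0 != y2 & y1 != y3] ->
    exists f, [/\ graph_aut E f, keeps_straight E tip f, keeps_straight E tip f^-1%g,
      forall x, rk (val (f x)) = rk (val x) & [/\ f x0 = y0, f x1 = y1, f x2 = y2 & f x3 = y3]]) ->
  regular P.
Proof.
move=> H A B fA fB; have [qA qfA AE] := flag_quad fA; have [qB qfB BE] := flag_quad fB.
have arcs (q : quad) : quad_flag q -> let: (a, b, c, z) := q in exists x0 x1 x2 x3 : V,
    [/\ rk (val x0) = 1%R, val x1 = c, val x2 = b,
      [/\ E x0 x1, E x1 x2, E x2 x3, x0 != x2 & x1 != x3]
      & [/\ tip a x0, tip a x2, tip z x1 & tip z x3]].
  case: q => [[[a b] c] z] qf.
  have [[_ [b1 /andP[b2 b3] b4] [c1 /andP[c2 c3] c4] _] _] := quad_others qf.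
  have /quad_flagP[[ra rb rc rz] ab bc cz] := qf.
  have [x0 x0E] := medial_ex1 b1; have [x1 x1E] := medial_ex2 rc.
  have [x2 x2E] := medial_ex1 rb; have [x3 x3E] := medial_ex2 c1.
  exists x0, x1, x2, x3; split=> //; first by rewrite x0E.
    split.
    - by rewrite E12 x0E // x1E rc b3.
    - by rewrite E21 x1E // x2E rb bc.
    - by rewrite E12 x2E // x3E c1 c2.
    - by rewrite -(inj_eq val_inj) x0E x2E.
    by rewrite -(inj_eq val_inj) x1E x3E eq_sym.
  by split; [left|left|right|right]; rewrite ?x0E ?x1E ?x2E ?x3E.
move: (arcs _ qfA) (arcs _ qfB).
case: qA qfA AE => [[[a b] c] z] qfA AE; case: qB qfB BE => [[[a' b'] c'] z'] qfB BE.
move=> [x0 [x1 [x2 [x3 [rx x1E x2E xarc [t0 t2 t1 t3]]]]]].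
move=> [y0 [y1 [y2 [y3 [ry y1E y2E yarc [u0 u2 u1 u3]]]]]].
have [f [fA' fs fsV frk [f0 f1 f2 f3]]] := H _ _ _ _ _ _ _ _ rx ry xarc yarc.
have [F FE FA] := medial_extend (s := false) fA' fs fsV frk; exists F => //.
have tF p w : tip p w -> tip (F p) (f w) by apply: tip_aut => // u; rewrite FE.
have Fb : F b = b' by rewrite -x2E FE f2.
have Fc : F c = c' by rewrite -x1E FE f1.
have [y01 y12 y23 y02 y13] := yarc.
have Fa : F a = a'.
  have [p [_ _ U]] := tip_meet y01 (etrans (E_sym _ _) y12) y02.
  by rewrite (U a') // (U (F a)) // -?f0 -?f2; apply: tF.
have Fz : F z = z'.
  have [p [_ _ U]] := tip_meet y12 (etrans (E_sym _ _) y23) y13.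
  by rewrite (U z') // (U (F z)) // -?f1 -?f3; apply: tF.
apply/eqP; rewrite eqEcard card_imset ?(flag_card HP fA) ?(flag_card HP fB) //;
  last exact: perm_inj.
rewrite leqnn andbT; apply/subsetP=> _ /imsetP[x xA ->]; move: xA.
rewrite AE BE !inE -!orbA => /or4P[/eqP->|/eqP->|/eqP->|/or3P[]/eqP->];
  by rewrite ?aut_bot ?aut_top ?Fa ?Fb ?Fc ?Fz ?eqxx ?orbT.
Qed.

(* If q = 2, the condition on [s2] does not exclude a reflection fixing the two
   vertices of the digon, so this case is treated apart: the graph is complete
   bipartite and all its automorphisms preserve straight arcs. *)
Lemma digon_regular : m = 2 -> regular P.
Proof.
move=> m2; apply: regular_of_three_arcs.
have digon a b c z : rk a = 0%R -> rk b = 1%R -> rk c = 2%R -> rk z = 3%R ->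
    a < b -> b < z -> a < c -> c < z -> b < c.
  move=> ra rb rc rz ab bz ac cz; have az := lt_trans ab bz.
  have [_ /(_ ra rz) + _] := ty az; rewrite m2 => -[v [e [_ _ vP eP inc]]].
  have [i ->] : exists i, b = v i by apply/vP; rewrite ab bz ra.
  have [k ->] : exists k, c = e k by apply/eP; rewrite ac cz ra.
  by rewrite inc; case: i k => -[|[|i]] ? [[|[|k]] ?].
(* Incidence of [b0] with the 2-face [q.1.2] survives every adjacency: when this face changes and
   [b] is not [b0], the edges [b] and [b0] meet in a vertex [p] of the triangle, and the digon
   between [p] and [z] applies. *)
have sub (c0 b0 : P) : rk c0 = 2%R -> rk b0 = 1%R -> b0 < c0 ->
    forall q : quad, quad_flag q -> b0 < q.1.2.
  move=> rc0 rb0 bc0 q qf; have [a0 [z0 qf0]] := quad_through rb0 rc0 bc0.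
  apply: (@flag_ind (fun q : quad => b0 < q.1.2) _ (a0, b0, c0, z0)) => //.
  move=> [[[a b] c] z] qf' /= bc'; split=> //=.
  have [[_ _ [o1 /andP[o2 o3] o4] _] _] := quad_others qf'.
  have /quad_flagP[[ra rb rc rz] ab bc cz] := qf'.
  have [<-//|ne] := eqVneq b b0.
  have [_ _ + _] := triangle_facts (tri_below rc); rewrite bot_rk => T.
  have [||p [rp _ pb pb0 _]] := T _ _ rb rb0 _ _ ne; rewrite ?bot_lt ?rb ?rb0 //.
  apply: (digon p b0 _ z) => //; first exact: lt_trans bc' cz.
  exact: lt_trans pb o2.
have complete (b c : P) : rk b = 1%R -> rk c = 2%R -> b < c.
  move=> rb rc; have bt : b < top by rewrite lt_top ?rb.
  have [c0 /andP[bc0 _] rc0] := cover_up bt; rewrite rb in rc0.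
  have b1 : bot < c by rewrite bot_lt ?rc.
  have [b' /andP[_ bc'] rb'] := cover_down b1; rewrite rc in rb'.
  have [a' [z' qf']] := quad_through rb' rc bc'.
  exact: (sub _ _ rc0 rb bc0 _ qf').
have EE (x y : V) : E x y = (rk (val x) != rk (val y)).
  have [rx|rx] := medial_rk x.
    by rewrite E12 // rx; have [->|ry] := medial_rk y => //; rewrite ry complete.
  by rewrite E21 // rx; have [ry|->] := medial_rk y => //; rewrite ry complete.
have tip_same p (b c : V) : tip p b -> tip p c -> rk (val b) = rk (val c).
  by case=> -[-> rp _] [[-> rp' _]|[-> rp' _]] //; rewrite rp in rp'.
(* All 2-faces being adjacent to all 1-faces, [b1] and [b3] are both the second neighbour of [c]
   with tip [p]; so they coincide. *)
have straight_all f : graph_aut E f -> keeps_straight E tip f.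
  move=> fA b1 c b2 c' b3 b1c b2c b2c' b3c' n12 n32 cc' [p [p1 p2 p3]].
  have [w [_ _ _ U]] := tip_two_lines p2 b2c.
  have b3c : E b3 c by move: b2c; rewrite !EE (tip_same _ _ _ p2 p3).
  have [E1|E1] := U _ b1c p1; first by rewrite E1 eqxx in n12.
  have [E3|E3] := U _ b3c p3; first by rewrite E3 eqxx in n32.
  have [q [q1 q2 _]] : exists q, [/\ tip q (f b1), tip q (f b2) & forall p', tip p' (f b1) ->
    tip p' (f b2) -> p' = q].
    by apply: (@tip_meet (f c)); rewrite ?fA // (inj_eq perm_inj).
  by exists q; split=> //; rewrite E3 -E1.
move=> x0 x1 x2 x3 y0 y1 y2 y3 rx0 ry0 [x01 x12 x23 x02 x13] [y01 y12 y23 y02 y13].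
have nxt (u w : V) : E u w -> rk (val u) = 1%R -> rk (val w) = 2%R.
  by move=> uw ru; move: uw; rewrite E12 // => /andP[/eqP].
have nxt' (u w : V) : E u w -> rk (val u) = 2%R -> rk (val w) = 1%R.
  by move=> uw ru; move: uw; rewrite E21 // => /andP[/eqP].
have rx1 := nxt _ _ x01 rx0; have rx2 := nxt' _ _ x12 rx1; have rx3 := nxt _ _ x23 rx2.
have ry1 := nxt _ _ y01 ry0; have ry2 := nxt' _ _ y12 ry1; have ry3 := nxt _ _ y23 ry2.
(* Permutations supported on one rank act independently on the two ranks, and any rank-preserving
   permutation is an automorphism of a complete bipartite graph. *)
have swap (a b a' b' : V) r : a != b -> a' != b' -> rk (val a) = r -> rk (val b) = r ->
    rk (val a') = r -> rk (val b') = r -> exists f : {perm V},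
    [/\ forall u, rk (val (f u)) = rk (val u), forall u, rk (val u) <> r -> f u = u,
      f a = a' & f b = b'].
  move=> ab ab' ra rb ra' rb'.
  have trk (u w : V) : rk (val u) = r -> rk (val w) = r ->
      (forall v : V, rk (val (tperm u w v)) = rk (val v)) /\ (forall v : V,
        rk (val v) <> r -> tperm u w v = v).
    move=> ru rw; split=> v; first by case: tpermP => [->|->|] //; rewrite ru rw.
    by move=> rv; rewrite tpermD //; apply/eqP=> E'; case: rv; rewrite -E'.
  have [t1 t2] := trk a a' ra ra'.
  have rb1 : rk (val (tperm a a' b)) = r by rewrite t1.
  have [t3 t4] := trk _ b' rb1 rb'.
  exists (tperm a a' * tperm (tperm a a' b) b')%g; split.
  - by move=> u; rewrite permM t3 t1.
  - by move=> u ru; rewrite permM (t2 _ ru) (t4 _ ru).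
  - have n1 : tperm a a' b != a' by rewrite -[X in _ != X](tpermL a a') (inj_eq perm_inj) eq_sym.
    by rewrite permM tpermL tpermD // eq_sym.
  by rewrite permM tpermL.
have [f [f1 f2 fa fb]] := swap x0 x2 y0 y2 1%R x02 y02 rx0 rx2 ry0 ry2.
have [g [g1 g2 ga gb]] := swap x1 x3 y1 y3 2%R x13 y13 rx1 rx3 ry1 ry3.
have fgrk u : rk (val ((f * g)%g u)) = rk (val u) by rewrite permM g1 f1.
have fgA : graph_aut E (f * g)%g by move=> u w; rewrite !EE !fgrk.
exists (f * g)%g; split=> //; [exact: straight_all | exact/straight_all/graph_autV |].
by rewrite !permM fa fb (f2 x1) ?rx1 // (f2 x3) ?rx3 // ga gb g2 ?ry0 // g2 ?ry2.
Qed.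

(** * Local symmetries obtained from the base flag *)

Variable Phi : quad.
Hypothesis Phi_flag : quad_flag Phi.
Hypothesis Phi_even : even_linked Phi.

(** The [r0]-neighbour has the same [b] and [c], so one of the two flags is in the orbit of
    [Phi]. *)
Lemma even_quad (b c : P) : rk b = 1%R -> rk c = 2%R -> b < c ->
  exists a z, [/\ quad_flag (a, b, c, z), even_linked (a, b, c, z) & linked Phi (a, b, c, z)].
Proof.
move=> rb rc bc; have [a [z qf]] := quad_through rb rc bc.
case: (linked_orbits Phi_flag qf Phi_even) => H.
  by exists a, z; split=> //; exact: even_linked_trans H Phi_even.
exists (other bot a b), z; split=> //; first exact: (r0_flag qf).
exact: even_linked_trans H Phi_even.
Qed.

Lemma rotpair_of g (h : {perm V}) x y p q : poset_aut g -> (forall x, val (h x) = g (val x)) ->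
  h x = x -> E x y -> h y != y -> tip p y -> tip p (h y) -> g p <> p ->
  quad_flag q -> quad_map (g * g * g)%g q = q ->
  (forall p, tip p x -> g p = p) -> rotpair x g h.
Proof.
move=> gA hE hx xy hy py phy gp qf gq gt.
have [hm _ _] := three_cycle gA hE hx xy hy py phy gp.
have ggg : (g * g * g)%g = 1%g by apply: aut_rigid gq => //; do 2 apply: poset_autM => //.
split=> //; split=> //; first exact/graph_aut_in/restrict_aut.
apply/permP=> w; rewrite perm1; apply: val_inj; rewrite !expgS mulg1 !permM !hE.
by have := congr1 (fun k : {perm P} => k (val w)) ggg; rewrite !permM perm1.
Qed.

(** For [x] of rank 1, the automorphism taking a flag through [x] to its image under [r2] followed
    by [r3] turns the triangle above [x]; for rank 2, [r1] followed by [r0] does so below. Its cube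
    fixes a flag, hence is trivial. *)
Lemma rotation_at x : exists g h, rotpair x g h.
Proof.
have [y xy] := E_has_nb x; have [rx|rx] := medial_rk x.
  have := xy; rewrite E12 // => /andP[/eqP ry lt].
  have [a [z [qf eq _]]] := even_quad rx ry lt.
  have [g gA /= [ga gb gc gz]] := eq 3 2 isT isT.
  have [h hE] := aut_restrict gA; exists g, h.
  have [[[a1 a2 a3] _ [o1 /andP[o2 o3] o4] [z1 z2 z3]] _] := quad_others qf.
  have qf2 := r2_flag qf; have [[_ _ _ [z4 z5 z6]] _] := quad_others qf2.
  have /quad_flagP[[ra _ _ rz] ab bc cz] := qf.
  have hx : h x = x by apply: val_inj; rewrite hE.
  have hy : h y != y by rewrite -(inj_eq val_inj) hE gc.
  have t1 : tip z y by right.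
  have t2 : tip z (h y) by right; rewrite hE gc.
  have gz' : g z <> z by rewrite gz; apply/eqP.
  have [_ h3 g3] := three_cycle gA hE hx xy hy t1 t2 gz'.
  apply: (rotpair_of gA hE hx xy hy t1 t2 gz' qf).
    rewrite /= !permM !ga !gb; do 2 congr (_, _) => //.
    by have := congr1 val h3; rewrite !hE.
  (* [g] fixes the vertex [a] of [x], hence also the other one. *)
  move=> p /(tip1 rx)[rp px]; have [->//|pa] := eqVneq p a.
  have ba : bot < a by rewrite bot_lt ?ra.
  have H1 : bot < a < val x by rewrite ba.
  have [||_ _ _ U] := otherP H1; rewrite ?bot_rk ?ra ?rx //.
  rewrite (U p) ?rp ?px ?bot_lt ?rp ?ra //.
  by rewrite -(aut_other gA H1) ?bot_rk ?ra ?rx // aut_bot // ga gb.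
have := xy; rewrite E21 // => /andP[/eqP ry lt].
have [a [z [qf eq _]]] := even_quad ry rx lt.
have [g gA /= [ga gb gc gz]] := eq 0 1 isT isT.
have [h hE] := aut_restrict gA; exists g, h.
have [[_ [o1 /andP[o2 o3] o4] _ [z1 z2 z3]] _] := quad_others qf.
have qf2 := r1_flag qf; have [[[a4 a5 a6] _ _ _] _] := quad_others qf2.
have /quad_flagP[[ra _ _ rz] ab bc cz] := qf.
have hx : h x = x by apply: val_inj; rewrite hE.
have hy : h y != y by rewrite -(inj_eq val_inj) hE gb.
have t1 : tip a y by left.
have t2 : tip a (h y) by left; rewrite hE gb.
have ga' : g a <> a by rewrite ga; apply/eqP.
have [_ h3 g3] := three_cycle gA hE hx xy hy t1 t2 ga'.
apply: (rotpair_of gA hE hx xy hy t1 t2 ga' qf).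
  rewrite /= !permM !gc !gz; do 2 congr (_, _) => //; congr (_, _) => //.
  by have := congr1 val h3; rewrite !hE.
move=> p /(tip2 rx)[rp px]; have [->//|pa] := eqVneq p z.
have zt : z < top by rewrite lt_top ?rz.
have H1 : val x < z < top by rewrite cz.
have [||_ _ _ U] := otherP H1; rewrite ?top_rk ?rz ?rx //.
rewrite (U p) ?rp ?px ?lt_top ?rp ?rz //.
by rewrite -(aut_other gA H1) ?top_rk ?rz ?rx // aut_top // gz gc.
Qed.

(** The half-turn is given by [r0] and [r3]; as these commute, its square fixes a flag. If it fixed
    all neighbours of [x], it would fix the common tip [z] of two of them, which it moves; likewise
    [a] around [y]. *)
Lemma tau_at12 (x y : V) : rk (val x) = 1%R -> E x y ->
  exists t, [/\ t \in stab E x y, (t * t = 1)%g, t \notin nbfix E x & t \notin nbfix E y].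
Proof.
move=> rx xy; have := xy; rewrite E12 // => /andP[/eqP ry lt].
have [a [z [qf eq _]]] := even_quad rx ry lt.
have [g gA gq] := eq 0 3 isT isT.
have [h hE] := aut_restrict gA; exists h.
have gg : (g * g)%g = 1%g.
  apply: (aut_rigid _ qf); first exact: poset_autM.
  rewrite quad_mapM gq -quad_map_rr ?rr_flag // -quad_map_rr // gq.
  by have [_ [E0 _ _ E3]] := quad_others qf; rewrite /= E0 E3.
move: gq => /= [ga gb gc gz].
have [[[a1 a2 a3] [b1 /andP[b2 b3] b4] [c1 /andP[c2 c3] c4] [z1 z2 z3]] _] := quad_others qf.
have /quad_flagP[[ra _ _ rz] ab bc cz] := qf.
have hA := restrict_aut gA hE.
split.
- by apply/stabP; split; [exact: graph_aut_in | apply: val_inj; rewrite hE | apply: val_inj;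
  rewrite hE].
- apply/permP=> w; rewrite perm1; apply: val_inj; rewrite permM !hE.
  by have := congr1 (fun k : {perm P} => k (val w)) gg; rewrite permM perm1.
- apply/negP=> /nbfixP[_ hx fx]; have [w wE] := medial_ex2 c1.
  have xw : E x w by rewrite E12 // wE c1.
  have yw : y != w by rewrite -(inj_eq val_inj) wE eq_sym.
  have [q [_ _ U]] := tip_meet (etrans (E_sym _ _) xy) (etrans (E_sym _ _) xw) yw.
  have t1 : tip z y by right.
  have t2 : tip z w by right; rewrite wE.
  case/eqP: z3; rewrite -gz [RHS](U z) //; apply: U.
    by rewrite -(fx _ xy); apply: tip_aut.
  by rewrite -(fx _ xw); apply: tip_aut.
apply/negP=> /nbfixP[_ hy fy]; have [w wE] := medial_ex1 b1.
have yx : E y x by rewrite E_sym.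
have yw : E y w by rewrite E21 // wE b1.
have xw : x != w by rewrite -(inj_eq val_inj) wE eq_sym.
have [q [_ _ U]] := tip_meet xy (etrans (E_sym _ _) yw) xw.
have t1 : tip a x by left.
have t2 : tip a w by left; rewrite wE.
case/eqP: a3; rewrite -ga [RHS](U a) //; apply: U.
  by rewrite -(fy _ yx); apply: tip_aut.
by rewrite -(fy _ yw); apply: tip_aut.
Qed.

Lemma tau_at (x y : V) : E x y ->
  exists t, [/\ t \in stab E x y, (t * t = 1)%g, t \notin nbfix E x & t \notin nbfix E y].
Proof.
move=> xy; have [rx|rx] := medial_rk x; first exact: tau_at12.
have yx : E y x by rewrite E_sym.
have := xy; rewrite E21 // => /andP[/eqP ry _].
have [t [tS tt ty' tx]] := tau_at12 ry yx; exists t; split=> //.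
by rewrite stabC.
Qed.


(** The rotation [h] at [b2] taking [c] to [c'] fixes [p], so it takes [b1] to [b3]. By
    [rotation3_conj] its conjugate under [f] is a rotation of the polytope at [f b2], which fixes
    the common tip of [f b1] and [f b2]; this is then also a tip of [f b3]. *)
Lemma aut_keeps_straight f : vertex_transitive E -> graph_aut E f -> keeps_straight E tip f.
Proof.
move=> vt fA b1 c b2 c' b3 b1c b2c b2c' b3c' n12 n32 cc' [p [p1 p2 p3]].
have vt' x y : exists2 g, g \in aut_group E & g x = y.
  by have [g gA gx] := vt x y; exists g => //; exact: graph_aut_in.
have rot' x : exists b, [/\ b \in aut_group E, b x = x & forall y, E x y -> b y != y].
  by have [g [h [_ _ [hA hx hm _] _]]] := rotation_at x; exists h.
have [g [h [hp hc]]] : exists g h, rotpair b2 g h /\ h c = c'.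
  have [g [h hp]] := rotation_at b2; have [_ _ hr _] := hp.
  have [_ _ H] := rotation3_cycle E_cubic hr b2c.
  case/or3P: (H _ b2c') => /eqP E'; first by rewrite E' eqxx in cc'.
    by exists g, h.
  exists g^-1%g, h^-1%g; split; first exact: rotpairV.
  apply: (@perm_inj _ h); rewrite permKV E'.
  by case: hr => _ _ _ h3; rewrite perm_cube1.
have [gA hE hr gt] := hp; have [hA hb2 _ _] := hr.
have hb1 : h b1 = b3.
  have [b' [_ _ _ U]] := tip_two_lines p2 b2c'.
  have [E3|E3] := U _ b3c' p3; first by rewrite E3 eqxx in n32.
  have t1 : tip p (h b1) by rewrite -(gt _ p2); apply: tip_aut.
  have e1 : E (h b1) c' by rewrite -hc (graph_autE _ _ hA).
  have [E1|E1] := U _ e1 t1; last by rewrite E1 E3.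
  by case/eqP: n12; apply: (@perm_inj _ h); rewrite E1 hb2.
have [g' [h' [hp' hfE]]] : exists g' h', rotpair (f b2) g' h' /\ (h ^ f)%g = h'.
  have [g' [h' hp']] := rotation_at (f b2); have [_ _ hr' _] := hp'.
  have [E'|E'] := rotation3_conj E_sym E_cubic E_conn vt' rot' tau_at (graph_aut_in fA) hr hr'.
    by exists g', h'.
  by exists g'^-1%g, h'^-1%g; split=> //; exact: rotpairV.
have [g'A h'E _ gt'] := hp'.
have fb1c : E (f b1) (f c) by rewrite fA.
have fb2c : E (f b2) (f c) by rewrite fA.
have fn12 : f b1 != f b2 by rewrite (inj_eq perm_inj).
have [p' [t1 t2 _]] := tip_meet fb1c fb2c fn12.
exists p'; split=> //; rewrite -hb1 -permJ hfE -(gt' _ t2).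
exact: tip_aut.
Qed.

Lemma graph_aut_flip f : graph_aut E f ->
  exists s, forall x, rk (val (f x)) = flip_rk s (rk (val x)).
Proof.
move=> fA; have [x0 _] : exists x0 : V, true.
  case: Phi Phi_flag => [[[a b] c] z] /quad_flagP[[_ rb _ _] _ _ _].
  by have [u _] := medial_ex1 rb; exists u.
pose s := rk (val (f x0)) != rk (val x0).
have Erk u w : E u w -> rk (val w) = (3 - rk (val u))%R.
  have [ru|ru] := medial_rk u; first by rewrite E12 // => /andP[/eqP-> _]; rewrite ru.
  by rewrite E21 // => /andP[/eqP-> _]; rewrite ru.
exists s => x; have /connectP[p] := E_conn x0 x.
have : rk (val (f x0)) = flip_rk s (rk (val x0)).
  rewrite /flip_rk /s; have [->//|] := eqVneq; move=> /eqP ne.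
  by case: (medial_rk x0) (medial_rk (f x0)) ne => -> [] ->.
elim: p (x0) => [|y p IH] u /= fu; first by move=> _ ->.
case/andP=> uy pp lp; apply: (IH y) => //.
have uy' : E (f u) (f y) by rewrite fA.
by rewrite (Erk _ _ uy') (Erk _ _ uy) fu /flip_rk; case: (s).
Qed.


(** * Transitivity on arcs *)

Lemma linked_either i q : quad_flag q -> (i < 4)%N -> linked Phi q \/ linked Phi (rr i q).
Proof.
move=> qf i4; case: (linked_orbits Phi_flag qf Phi_even) => H; first by left.
right; have := even_linked_trans Phi_flag H Phi_even (i := i) (j := 0) i4 isT.
by rewrite /= r0K // => H'; exact: linked_trans H H'.
Qed.

(** [x], [y] and [p] leave one outer entry of the flag free, and one of its two values puts the flag
    in the orbit of [Phi]. *)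
Lemma tip_flag_linked (x y : V) p : E x y -> tip p y ->
  exists a b c z, [/\ quad_flag (a, b, c, z), linked Phi (a, b, c, z)
   & if rk (val x) == 2%R then [/\ p = a, val y = b & val x = c]
     else [/\ p = z, val y = c & val x = b]].
Proof.
have [rx|rx] := medial_rk x; rewrite rx /=.
  rewrite E12 // => /andP[/eqP ry xy] /(tip2 ry)[rp yp].
  have bx : bot < val x by rewrite bot_lt ?rx.
  have [a /andP[_ ax] ra] := cover_down bx; rewrite rx in ra.
  have qf : quad_flag (a, val x, val y, p) by apply/quad_flagP.
  case: (linked_either qf (i := 0) isT) => H.
    by exists a, (val x), (val y), p.
  by exists (other bot a (val x)), (val x), (val y), p; split=> //; exact: (r0_flag qf).
rewrite E21 // => /andP[/eqP ry xy] /(tip1 ry)[rp yp].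
have xt : val x < top by rewrite lt_top ?rx.
have [z /andP[xz _] rz] := cover_up xt; rewrite rx in rz.
have qf : quad_flag (p, val y, val x, z) by apply/quad_flagP.
case: (linked_either qf (i := 3) isT) => H.
  by exists p, (val y), (val x), z.
by exists p, (val y), (val x), (other (val x) z top); split=> //; exact: (r3_flag qf).
Qed.

Lemma tip_flag_transitive (x y x' y' : V) p p' : E x y -> tip p y -> E x' y' -> tip p' y' ->
  rk (val x) = rk (val x') ->
  exists g (h : {perm V}), [/\ poset_aut g, forall u : V, val (h u) = g (val u), h x = x',
    h y = y' & g p = p'].
Proof.
move=> xy py xy' py' rE.
have [a [b [c [z [qf L H]]]]] := tip_flag_linked xy py.
have [a' [b' [c' [z' [qf' L' H']]]]] := tip_flag_linked xy' py'.
have [g gA /= [ga gb gc gz]] := linked_trans (linked_sym L) L'.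
have [h hE] := aut_restrict gA; exists g, h; rewrite -rE in H'.
by case: ifP H H' => _ [-> yE xE] [-> yE' xE']; split=> //; apply: val_inj;
  rewrite hE ?xE ?yE ?xE' ?yE'.
Qed.

(** A 2-arc is determined by [x1], [x2] and the common tip [p] of its ends, since [x0] is the other
    neighbour of [x1] with tip [p]. *)
Lemma two_arc_transitive_same (x0 x1 x2 y0 y1 y2 : V) :
  E x0 x1 -> E x1 x2 -> x0 != x2 -> E y0 y1 -> E y1 y2 -> y0 != y2 ->
  rk (val x1) = rk (val y1) ->
  exists h, [/\ graph_aut E h, h x0 = y0, h x1 = y1 & h x2 = y2].
Proof.
move=> x01 x12 x02 y01 y12 y02 rE.
have [p [p0 p2 _]] := tip_meet x01 (etrans (E_sym _ _) x12) x02.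
have [p' [p0' p2' _]] := tip_meet y01 (etrans (E_sym _ _) y12) y02.
have [g [h [gA hE h1 h2 gp]]] := tip_flag_transitive x12 p2 y12 p2' rE.
have hA := restrict_aut gA hE; exists h; split=> //.
have [w [_ _ _ U]] := tip_two_lines p2' (etrans (E_sym _ _) y12).
have t0 : tip p' (h x0) by rewrite -gp; apply: tip_aut.
have e0 : E (h x0) y1 by rewrite -h1 hA.
have [E0|E0] := U _ y01 p0'; first by rewrite E0 eqxx in y02.
have [E1|E1] := U _ e0 t0; last by rewrite E0 E1.
by case/eqP: x02; apply: (@perm_inj _ h); rewrite E1 h2.
Qed.

Lemma chiral_vertex_transitive : vertex_transitive E -> ~ regular P ->
  t_transitive E 2 /\ self_dual P.
Proof.
move=> vt nreg; have fs f := @aut_keeps_straight f vt.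
have [u ru [w rw]] : exists2 u : V, rk (val u) = 1%R & exists w : V, rk (val w) = 2%R.
  case: Phi Phi_flag => [[[a b] c] z] /quad_flagP[[_ rb rc _] _ _ _].
  have [u uE] := medial_ex1 rb; have [w wE] := medial_ex2 rc.
  by exists u; [rewrite uE | exists w; rewrite wE].
have [f fA fu] := vt u w.
have frk x : rk (val (f x)) = flip_rk true (rk (val x)).
  have [s sE] := graph_aut_flip fA; have := sE u; rewrite fu ru rw.
  by case: s sE => // sE _; exact: sE.
split; last first.
  have [F _ FD] := medial_extend fA (fs _ fA) (fs _ (graph_autV fA)) frk.
  by exists F.
split.
  move=> v v' [v1 v2] [v1' v2'].
  pose o0 := @Ordinal 3 0 isT; pose o1 := @Ordinal 3 1 isT; pose o2 := @Ordinal 3 2 isT.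
  have arc3 (x : 'I_3 -> V) : is_arc E x -> [/\ E (x o0) (x o1), E (x o1) (x o2) & x o0 != x o2].
    by case=> h1 h2; split; [exact: h1 | exact: h1 | apply/eqP; exact: h2].
  have [a01 a12 a02] := arc3 _ (conj v1 v2); have [b01 b12 b02] := arc3 _ (conj v1' v2').
  have fin h : graph_aut E h -> h (v o0) = v' o0 -> h (v o1) = v' o1 -> h (v o2) = v' o2 ->
      exists2 f0, graph_aut E f0 & forall i, f0 (v i) = v' i.
    move=> hA h0 h1 h2; exists h => // -[[|[|[|i]]] lt] //.
    - by rewrite (_ : Ordinal lt = o0) //; apply: val_inj.
    - by rewrite (_ : Ordinal lt = o1) //; apply: val_inj.
    by rewrite (_ : Ordinal lt = o2) //; apply: val_inj.
  have [rE|rE] := eqVneq (rk (val (v o1))) (rk (val (v' o1))).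
    have [h [hA h0 h1 h2]] := two_arc_transitive_same a01 a12 a02 b01 b12 b02 rE.
    exact: fin hA h0 h1 h2.
  (* When the middle vertices have different ranks, [f] first moves the arc to the other type. *)
  have [||||h [hA h0 h1 h2]] := @two_arc_transitive_same (f (v o0)) (f (v o1)) (f (v o2)) (v'
    o0) (v' o1) (v' o2) _ _ _ b01 b12 b02.
  - by rewrite fA.
  - by rewrite fA.
  - by rewrite (inj_eq perm_inj).
  - by rewrite frk; move: rE; case: (medial_rk (v o1)) (medial_rk (v' o1)) => -> [] ->.
  apply: (fin (f * h)%g); rewrite ?permM //.
  by move=> x y; rewrite !permM hA fA.
move=> at3; apply: nreg; apply: regular_of_three_arcs.
move=> x0 x1 x2 x3 y0 y1 y2 y3 rx0 ry0 xarc yarc.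
have mk (z0 z1 z2 z3 : V) : [/\ E z0 z1, E z1 z2, E z2 z3, z0 != z2 & z1 != z3] ->
    is_arc E (fun i : 'I_4 => nth z0 [:: z0; z1; z2; z3] i).
  case=> h1 h2 h3 /eqP h4 /eqP h5; split=> -[[|[|[|[|i]]]] ?] // [[|[|[|[|k]]]] ?] //.
have [g gA gE] := at3 _ _ (mk _ _ _ _ xarc) (mk _ _ _ _ yarc).
have g0 := gE (@Ordinal 4 0 isT); have g1 := gE (@Ordinal 4 1 isT).
have g2 := gE (@Ordinal 4 2 isT); have g3 := gE (@Ordinal 4 3 isT).
exists g; split=> //; [exact: fs | exact/fs/graph_autV |].
(* [g] takes the 1-face [x0] to the 1-face [y0], so it preserves all ranks. *)
have [s sE] := graph_aut_flip gA; have := sE x0; rewrite [g x0]g0 ry0 rx0.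
by case: s sE => // sE _; exact: sE.
Qed.

End Polytope.

Theorem theorem3 (d : Order.disp_t) (P : finPOrderType d) (rk : P -> int)
    (q : nat) :
  (2 <= q)%N ->
  is_4polytope rk ->
  has_type rk 3 q 3 ->
  chiral rk ->
  vertex_transitive (medial_layer_graph rk) ->
  t_transitive (medial_layer_graph rk) 2 /\ self_dual P.
Proof.
move=> q2 HP ty [nreg [A fA [s1 [s2 [s3 [R1 R2 R3]]]]]] vt.
have [bot bot_rk bot_le] := least_face HP; have [top top_rk le_top] := greatest_face HP.
(* For [q = 2] regularity contradicts chirality; otherwise all polygons have at least three edges,
   as [rotation_linked] requires. *)
have [q_eq|q_ne] := eqVneq q 2.
  by case: nreg; exact: (digon_regular HP bot_rk bot_le top_rk le_top ty q_eq).
have [Phi Phi_flag AE] := flag_quad HP bot_rk bot_le top_rk le_top fA; subst A.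
apply: (chiral_vertex_transitive HP bot_rk bot_le top_rk le_top ty Phi_flag) => //.
apply: even_linked_base => //; case: Phi Phi_flag {fA} R1 R2 R3 => [[[a b] c] z] Phi_flag R1 R2 R3.
case=> [|[|[|]]] // _.
- apply: (rotation_linked HP bot_rk bot_le top_rk le_top Phi_flag _ R1) =>
  // n F G v e FG lab rF rG.
  by have [/(_ rF rG) H _ _] := ty _ _ FG; rewrite (polygon_card H lab).
- apply: (rotation_linked HP bot_rk bot_le top_rk le_top Phi_flag _ R2) =>
  // n F G v e FG lab rF rG.
  by have [_ /(_ rF rG) H _] := ty _ _ FG; rewrite (polygon_card H lab) ltn_neqAle eq_sym q_ne.
apply: (rotation_linked HP bot_rk bot_le top_rk le_top Phi_flag _ R3) => // n F G v e FG lab rF rG.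
by have [_ _ /(_ rF rG) H] := ty _ _ FG; rewrite (polygon_card H lab).
Qed.
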